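(* For single patterns in $S_3$ the following hold: (i) $[132]_{\mathrm{fp},\mathrm{exc},\mathrm{inv},\mathrm{crs},\mathrm{nes}}=\{132,213\}$; (ii) $[231]_{\mathrm{fp},\mathrm{inv},\mathrm{nes}}=\{231,312\}$; (iii) $[132]_{\mathrm{fp},\mathrm{exc},\mathrm{crs}}=\{132,213,321\}$.
   Context: $S_n(\tau)$: permutations of $[n]$ avoiding the pattern $\tau$. For $\sigma\in S_n$: $\mathrm{fp}(\sigma)=|\{i:\sigma(i)=i\}|$; $\mathrm{exc}(\sigma)=|\{i:\sigma(i)>i\}|$; $\mathrm{inv}(\sigma)=|\{(i,j):i<j,\ \sigma(i)>\sigma(j)\}|$; a crossing is a pair $(i,j)$ with $i<j<\sigma(i)<\sigma(j)$ or $\sigma(i)<\sigma(j)\le i<j$, a nesting a pair with $i<j<\sigma(j)<\sigma(i)$ or $\sigma(j)<\sigma(i)\le i<j$, and $\mathrm{crs},\mathrm{nes}$ count them. Patterns $\tau,\tau'$ are $(\mathrm{st}_1,\dots,\mathrm{st}_k)$-Wilf-equivalent if for every $n$, $\sum_{\sigma\in S_n(\tau)}\prod_i x_i^{\mathrm{st}_i(\sigma)}=\sum_{\sigma\in S_n(\tau')}\prod_i x_i^{\mathrm{st}_i(\sigma)}$. $[\tau]_{\mathrm{st}_1,\dots,\mathrm{st}_k}$ denotes the set of $\tau'\in S_3$ that are $(\mathrm{st}_1,\dots,\mathrm{st}_k)$-Wilf-equivalent to $\tau$. *)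

(* Defs.v *)
From mathcomp Require Import all_boot all_order all_fingroup all_algebra.
From mathcomp Require Import mpoly.

Set Implicit Arguments.
Unset Strict Implicit.
Unset Printing Implicit Defensive.

Import GRing.Theory.

(* Permutations of [n] = {1, .., n} are elements of 'S_n, i.e. permutations of
   {0, .., n-1}. Both positions and values are shifted by one, so the
   comparisons between positions and values below are unaffected. *)

Lemma one_line_inj (n : nat) (w : seq nat) :
  perm_eq w (iota 1 n.+1) ->
  injective (fun i : 'I_n.+1 => inord (nth 0 w i).-1 : 'I_n.+1).
Proof.
move=> hw i j.
have sz : size w = n.+1 by rewrite (perm_size hw) size_iota.
have bnd (k : 'I_n.+1) : 0 < nth 0 w k <= n.+1.
  have: nth 0 w k \in w by rewrite mem_nth // sz.
  by rewrite (perm_mem hw) mem_iota add1n ltnS.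
have /andP[i0 in1] := bnd i; have /andP[j0 jn1] := bnd j.
move/(congr1 (@nat_of_ord _)); rewrite !inordK ?prednK // => eqij.
apply/val_inj/eqP; rewrite /= -(nth_uniq 0 _ _ (_ : uniq w)) ?sz //.
  by rewrite -(prednK i0) -(prednK j0) eqij.
by rewrite (perm_uniq hw) iota_uniq.
Qed.

(* The permutation whose (1-based) one-line notation is w. *)
Definition one_line (n : nat) (w : seq nat)
  (hw : perm_eq w (iota 1 n.+1)) : 'S_n.+1 := perm (one_line_inj hw).

Lemma one_lineE (n : nat) (w : seq nat) (hw : perm_eq w (iota 1 n.+1))
  (i : 'I_n.+1) : (one_line hw i).+1 = nth 0 w i.
Proof.
have: nth 0 w i \in w.
  by rewrite mem_nth // (perm_size hw) size_iota.
rewrite (perm_mem hw) mem_iota add1n ltnS => /andP[w0 wn].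
by rewrite permE inordK ?prednK.
Qed.

Definition p132 : 'S_3 := @one_line 2 [:: 1; 3; 2] isT.
Definition p213 : 'S_3 := @one_line 2 [:: 2; 1; 3] isT.
Definition p231 : 'S_3 := @one_line 2 [:: 2; 3; 1] isT.
Definition p312 : 'S_3 := @one_line 2 [:: 3; 1; 2] isT.
Definition p321 : 'S_3 := @one_line 2 [:: 3; 2; 1] isT.

Definition contains (k n : nat) (tau : 'S_k) (sigma : 'S_n) : bool :=
  [exists f : {ffun 'I_k -> 'I_n},
     [forall a : 'I_k, forall b : 'I_k, (a < b) ==> (f a < f b)] &&
     [forall a : 'I_k, forall b : 'I_k,
        (sigma (f a) < sigma (f b)) == (tau a < tau b)]].

Definition avoiders (k : nat) (tau : 'S_k) (n : nat) : {set 'S_n} :=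
  [set sigma | ~~ contains tau sigma].

Definition perm_stat : Type := forall n : nat, 'S_n -> nat.

Definition st_fp : perm_stat := fun n s => #|[set i : 'I_n | s i == i]|.

Definition st_exc : perm_stat := fun n s => #|[set i : 'I_n | i < s i]|.

Definition st_inv : perm_stat := fun n s =>
  #|[set ij : 'I_n * 'I_n | (ij.1 < ij.2) && (s ij.2 < s ij.1)]|.

Definition crossing (n : nat) (s : 'S_n) (i j : 'I_n) : bool :=
  [&& i < j, j < s i & s i < s j] || [&& s i < s j, s j <= i & i < j].

Definition nesting (n : nat) (s : 'S_n) (i j : 'I_n) : bool :=
  [&& i < j, j < s j & s j < s i] || [&& s j < s i, s i <= i & i < j].

Definition st_crs : perm_stat := fun n s =>
  #|[set ij : 'I_n * 'I_n | crossing s ij.1 ij.2]|.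

Definition st_nes : perm_stat := fun n s =>
  #|[set ij : 'I_n * 'I_n | nesting s ij.1 ij.2]|.

Definition gen_poly (m : nat) (st : m.-tuple perm_stat) (k : nat) (tau : 'S_k)
  (n : nat) : {mpoly int[m]} :=
  (\sum_(sigma in avoiders tau n)
      \prod_(i < m) 'X_i ^+ (tnth st i n sigma))%R.

Definition wilf_equiv (m : nat) (st : m.-tuple perm_stat) (k k' : nat)
  (tau : 'S_k) (tau' : 'S_k') : Prop :=
  forall n : nat, gen_poly st tau n = gen_poly st tau' n.

(* [tau]_{st}, as a predicate on S_3: Wilf-equivalence quantifies over all n,
   so it is not a boolean predicate and does not form a {set 'S_3}. *)
Definition wilf_class (m : nat) (st : m.-tuple perm_stat) (tau : 'S_3) :
  'S_3 -> Prop := fun tau' => wilf_equiv st tau tau'.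

(* Main.v *)
Require Import Defs.
From mathcomp Require Import all_boot all_fingroup.
From mathcomp Require Import all_order all_algebra.
From mathcomp Require Import mpoly zify ring.

Set Implicit Arguments.
Unset Strict Implicit.
Unset Printing Implicit Defensive.

Import GRing.Theory.

(** Inequivalences are already visible at n = 3, where avoiding tau means being
    different from tau.  The symmetry s |-> rev s^-1 rev preserves all five
    statistics and exchanges 132 and 213; inversion preserves fp, inv and nes
    and exchanges 231 and 312.

    The equivalence of 132 and 321 for (fp, exc, crs) holds because both
    generating functions count the same weighted Motzkin paths.  A permutation
    avoiding 321 is determined by its excedance positions and excedance values,
    hence by a bicoloured Motzkin path whose heights h_p give
    crs = sum_p (h_p - [p is an excedance value]).  A permutation avoiding 132,
    of the form L n R with L > R, corresponds to the Dyck path U L D R.  The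
    entry s(j) then becomes a pair of matched steps whose centre is at distance
    s(j) - j from the middle line, and crs and exc are determined by how the
    pairs of matched steps meet that line.  Reading the Dyck path outwards from
    its middle, two steps at a time, gives a walk on the states (a, b) of the
    unmatched down and up steps.  The weighted number of walks reaching (a, b)
    depends only on h = (a + b) / 2, and as a function of h it satisfies the
    recursion of the Motzkin paths above. *)

(** * Sums over matched sets, and occurrences of patterns of length three *)

(** Reindexing along a bijection given only as a relation, so that neither direction has to be built
    as a function. Each head of [s] is matched with its partner, which is then removed from [t]. *)
Lemma big_rel (V : nmodType) (S T : eqType) (s : seq S) (t : seq T)
    (E : S -> T -> Prop) (F : S -> V) (G : T -> V) :
  uniq s -> uniq t ->
  {in s, forall x, exists2 y, y \in t & E x y} ->
  {in t, forall y, exists2 x, x \in s & E x y} ->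
  (forall x y y', E x y -> E x y' -> y = y') ->
  (forall x x' y, E x y -> E x' y -> x = x') ->
  (forall x y, x \in s -> y \in t -> E x y -> F x = G y) ->
  (\sum_(x <- s) F x = \sum_(y <- t) G y)%R.
Proof.
move=> us ut st ts fE gE FG.
elim: s t us ut st ts FG => [|x s IH] t /=.
  move=> _ _ _ ts _; case: t ts => [|y t] ts; first by rewrite !big_nil.
  by have [] := ts y (mem_head _ _).
case/andP=> xs us ut st ts FG.
have [y yt Exy] := st x (mem_head _ _).
rewrite big_cons (perm_big _ (perm_to_rem yt)) big_cons (FG x y) ?mem_head //.
congr (_ + _)%R; apply: IH => //; first exact: rem_uniq.
- move=> x' x's; have [y' y't E'] := st x' (mem_behead (s := x :: s) x's).
  exists y' => //; rewrite mem_rem_uniq // inE /= y't andbT.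
  by apply/eqP => e; rewrite e in E'; rewrite (gE _ _ _ Exy E') x's in xs.
- move=> y'; rewrite mem_rem_uniq // inE /= => /andP[ny y't].
  have [x' + E'] := ts y' y't; rewrite inE => /predU1P[e|x's]; last by exists x'.
  by rewrite e in E'; rewrite (fE _ _ _ Exy E') eqxx in ny.
move=> x' y' x's; rewrite mem_rem_uniq // inE /= => /andP[_ y't].
by apply: FG => //; rewrite inE x's orbT.
Qed.

(** Three comparisons suffice: those with exchanged arguments are their negations, by injectivity of
    both permutations, and the diagonal ones are false. *)
Lemma containsP (n : nat) (tau : 'S_3) (s : 'S_n) :
  reflect (exists i j k : 'I_n, [/\ i < j < k,
     (s i < s j) = (tau (inord 0) < tau (inord 1)),
     (s i < s k) = (tau (inord 0) < tau (inord 2)) &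
     (s j < s k) = (tau (inord 1) < tau (inord 2))])
   (contains tau s).
Proof.
have o3 (a : 'I_3) : [\/ a = inord 0, a = inord 1 | a = inord 2].
  case: a => [[|[|[|//]]] lt]; [constructor 1|constructor 2|constructor 3];
  by apply: val_inj; rewrite /= inordK.
have flip m (r : 'S_m) (x y : 'I_m) : x != y -> (r y < r x) = ~~ (r x < r y).
  move=> nxy; have : r x <> r y :> nat by move/val_inj/perm_inj/eqP; apply/negP.
  lia.
apply: (iffP existsP) => [[f /andP[/forallP mono /forallP pat]]|].
  have mf (a b : 'I_3) : a < b -> f a < f b.
    by move=> ab; have /forallP/(_ b)/implyP := mono a; apply.
  have pf (a b : 'I_3) : (s (f a) < s (f b)) = (tau a < tau b).
    by have /forallP/(_ b)/eqP := pat a.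
  exists (f (inord 0)), (f (inord 1)), (f (inord 2)); split=> //.
  by rewrite !mf // !inordK.
move=> [i [j [k [/andP[ij jk] e1 e2 e3]]]].
have ik := ltn_trans ij jk.
have neq (x y : 'I_n) : x < y -> x != y by move=> xy; apply: contraL xy => /eqP->; rewrite ltnn.
exists [ffun a : 'I_3 => if a == inord 0 then i else if a == inord 1 then j else k].
have n10 : (inord 1 == inord 0 :> 'I_3) = false by apply/eqP => /(congr1 val); rewrite /= !inordK.
have n20 : (inord 2 == inord 0 :> 'I_3) = false by apply/eqP => /(congr1 val); rewrite /= !inordK.
have n21 : (inord 2 == inord 1 :> 'I_3) = false by apply/eqP => /(congr1 val); rewrite /= !inordK.
apply/andP; split; apply/forallP => a; apply/forallP => b; rewrite !ffunE.
  case: (o3 a) => ->; case: (o3 b) => ->; rewrite ?eqxx ?n10 ?n20 ?n21 ?inordK //=;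
  by rewrite ?ij ?jk ?ik ?ltnn.
case: (o3 a) => ->; case: (o3 b) => ->; rewrite ?eqxx ?n10 ?n20 ?n21 /= ?ltnn ?e1 ?e2 ?e3 ?eqxx //.
- by rewrite (flip _ s i j) ?neq // (flip _ tau (inord 0)) 1?eq_sym ?n10 // e1.
- by rewrite (flip _ s i k) ?neq // (flip _ tau (inord 0)) 1?eq_sym ?n20 // e2.
- by rewrite (flip _ s j k) ?neq // (flip _ tau (inord 1)) 1?eq_sym ?n21 // e3.
Qed.

Lemma patE (w : seq nat) (hw : perm_eq w (iota 1 3)) (i j : nat) :
  i < 3 -> j < 3 ->
  (one_line hw (inord i) < one_line hw (inord j)) = (nth 0 w i < nth 0 w j).
Proof. by move=> i3 j3; rewrite -ltnS !one_lineE !inordK. Qed.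

(** * Symmetries *)

Lemma card_set_sum (T : finType) (P : pred T) : #|[set x | P x]| = \sum_x P x.
Proof. by rewrite -sum1dep_card big_mkcond; apply: eq_bigr => x _; case: (P x). Qed.

Lemma card_pair_sum (T : finType) (P : T -> T -> bool) :
  #|[set x : T * T | P x.1 x.2]| = \sum_x \sum_y P x y.
Proof. by rewrite card_set_sum pair_bigA. Qed.

Lemma st_invE (n : nat) (s : 'S_n) :
  st_inv s = \sum_(i < n) \sum_(j < n) ((i < j) && (s j < s i)).
Proof. exact: (card_pair_sum (fun i j : 'I_n => (i < j) && (s j < s i))). Qed.

Lemma st_crsE (n : nat) (s : 'S_n) : st_crs s = \sum_i \sum_j crossing s i j.
Proof. exact: (card_pair_sum (crossing s)). Qed.

Lemma st_nesE (n : nat) (s : 'S_n) : st_nes s = \sum_i \sum_j nesting s i j.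
Proof. exact: (card_pair_sum (nesting s)). Qed.

Lemma wilf_equiv_bij (m : nat) (st : m.-tuple perm_stat) (tau tau' : 'S_3)
    (phi : forall n, 'S_n -> 'S_n) :
  (forall n, injective (phi n)) ->
  (forall n (s : 'S_n), contains tau' (phi n s) = contains tau s) ->
  (forall n (s : 'S_n) i, tnth st i n (phi n s) = tnth st i n s) ->
  wilf_equiv st tau tau'.
Proof.
move=> inj_phi cE stE n; rewrite /gen_poly [RHS](reindex_inj (inj_phi n)) /=.
apply: eq_big => [s|s _]; first by rewrite !inE cE.
by apply: eq_bigr => i _; rewrite stE.
Qed.

(** Reflection of the diagram in its antidiagonal: the point [(i, s i)] goes to
    [(rev_ord (s i), rev_ord i)], which preserves the displacement of value against position. *)
Definition rci (n : nat) (s : 'S_n) : 'S_n :=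
  (perm rev_ord_inj * s^-1 * perm rev_ord_inj)%g.

Lemma rciE (n : nat) (s : 'S_n) i : rci s (rev_ord (s i)) = rev_ord i.
Proof. by rewrite /rci !permM !(permE rev_ord_inj) rev_ordK permK. Qed.

Lemma rci_inj (n : nat) : injective (@rci n).
Proof. by move=> s t /mulIg/mulgI/invg_inj. Qed.

Lemma sum_rci (n : nat) (s : 'S_n) (F : 'I_n -> 'I_n -> nat) :
  \sum_i F i (rci s i) = \sum_i F (rev_ord (s i)) (rev_ord i).
Proof.
rewrite (reindex_inj rev_ord_inj) (reindex_inj (@perm_inj _ s)) /=.
by apply: eq_bigr => i _; rewrite rciE.
Qed.

(** The indices are exchanged on the right because the two arcs of a crossing swap roles under the
    reflection. Inversions and nestings keep their roles, so their proofs undo the exchange. *)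
Lemma sum2_rci (n : nat) (s : 'S_n) (F : 'I_n -> 'I_n -> 'I_n -> 'I_n -> nat) :
  \sum_i \sum_j F i (rci s i) j (rci s j) =
  \sum_i \sum_j F (rev_ord (s j)) (rev_ord j) (rev_ord (s i)) (rev_ord i).
Proof.
rewrite (sum_rci s (fun i a => \sum_j F i a j (rci s j))) [RHS]exchange_big /=.
apply: eq_bigr => i _.
by rewrite (sum_rci s (fun j b => F (rev_ord (s i)) (rev_ord i) j b)).
Qed.

Lemma fp_rci (n : nat) (s : 'S_n) : st_fp (rci s) = st_fp s.
Proof.
rewrite /st_fp !card_set_sum (sum_rci s (fun i a => (a == i) : nat)).
by apply: eq_bigr => i _; rewrite (inj_eq rev_ord_inj) eq_sym.
Qed.

Lemma exc_rci (n : nat) (s : 'S_n) : st_exc (rci s) = st_exc s.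
Proof.
rewrite /st_exc !card_set_sum (sum_rci s (fun i a => (i < a) : nat)).
apply: eq_bigr => i _ /=; have := ltn_ord i; have := ltn_ord (s i); lia.
Qed.

Lemma inv_rci (n : nat) (s : 'S_n) : st_inv (rci s) = st_inv s.
Proof.
rewrite !st_invE.
rewrite (sum2_rci s (fun i a j b => (i < j) && (b < a) : nat)).
rewrite exchange_big; apply: eq_bigr => i _; apply: eq_bigr => j _ /=.
move: (ltn_ord i) (ltn_ord (s i)) (ltn_ord j) (ltn_ord (s j)); lia.
Qed.

Lemma crs_rci (n : nat) (s : 'S_n) : st_crs (rci s) = st_crs s.
Proof.
rewrite !st_crsE /crossing.
rewrite (sum2_rci s (fun i a j b =>
  [&& i < j, j < a & a < b] || [&& a < b, b <= i & i < j] : nat)).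
apply: eq_bigr => i _; apply: eq_bigr => j _ /=.
move: (ltn_ord i) (ltn_ord (s i)) (ltn_ord j) (ltn_ord (s j)); lia.
Qed.

Lemma nes_rci (n : nat) (s : 'S_n) : st_nes (rci s) = st_nes s.
Proof.
rewrite !st_nesE /nesting.
rewrite (sum2_rci s (fun i a j b =>
  [&& i < j, j < b & b < a] || [&& b < a, a <= i & i < j] : nat)).
rewrite exchange_big; apply: eq_bigr => i _; apply: eq_bigr => j _ /=.
move: (ltn_ord i) (ltn_ord (s i)) (ltn_ord j) (ltn_ord (s j)); lia.
Qed.

Lemma perm_neq3 (n : nat) (s : 'S_n) (i j k : 'I_n) : i < j < k ->
  [/\ s i != s j :> nat, s i != s k :> nat & s j != s k :> nat].
Proof.
by move=> ijk; split; apply/eqP => /val_inj/perm_inj e; move: ijk; rewrite e; lia.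
Qed.

Lemma contains132P (n : nat) (s : 'S_n) :
  reflect (exists i j k : 'I_n, i < j < k /\ s i < s k < s j) (contains p132 s).
Proof.
apply: (iffP (containsP _ _)) => -[i [j [k]]].
  rewrite !patE //= => -[h1 h2 h3 h4]; exists i, j, k; split => //.
  by have [] := perm_neq3 s h1; lia.
by move=> [h1 h2]; exists i, j, k; rewrite !patE //=; split=> //; lia.
Qed.

Lemma contains213P (n : nat) (s : 'S_n) :
  reflect (exists i j k : 'I_n, i < j < k /\ s j < s i < s k) (contains p213 s).
Proof.
apply: (iffP (containsP _ _)) => -[i [j [k]]].
  rewrite !patE //= => -[h1 h2 h3 h4]; exists i, j, k; split => //.
  by have [] := perm_neq3 s h1; lia.
by move=> [h1 h2]; exists i, j, k; rewrite !patE //=; split=> //; lia.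
Qed.

Lemma contains231P (n : nat) (s : 'S_n) :
  reflect (exists i j k : 'I_n, i < j < k /\ s k < s i < s j) (contains p231 s).
Proof.
apply: (iffP (containsP _ _)) => -[i [j [k]]].
  rewrite !patE //= => -[h1 h2 h3 h4]; exists i, j, k; split => //.
  by have [] := perm_neq3 s h1; lia.
by move=> [h1 h2]; exists i, j, k; rewrite !patE //=; split=> //; lia.
Qed.

Lemma contains312P (n : nat) (s : 'S_n) :
  reflect (exists i j k : 'I_n, i < j < k /\ s j < s k < s i) (contains p312 s).
Proof.
apply: (iffP (containsP _ _)) => -[i [j [k]]].
  rewrite !patE //= => -[h1 h2 h3 h4]; exists i, j, k; split => //.
  by have [] := perm_neq3 s h1; lia.
by move=> [h1 h2]; exists i, j, k; rewrite !patE //=; split=> //; lia.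
Qed.

Lemma contains321P (n : nat) (s : 'S_n) :
  reflect (exists i j k : 'I_n, i < j < k /\ s k < s j < s i) (contains p321 s).
Proof.
apply: (iffP (containsP _ _)) => -[i [j [k]]].
  rewrite !patE //= => -[h1 h2 h3 h4]; exists i, j, k; split => //.
  by have [] := perm_neq3 s h1; lia.
by move=> [h1 h2]; exists i, j, k; rewrite !patE //=; split=> //; lia.
Qed.

Lemma contains_rci (n : nat) (s : 'S_n) : contains p213 (rci s) = contains p132 s.
Proof.
apply/contains213P/contains132P => -[i [j [k [ijk sijk]]]]; last first.
  exists (rev_ord (s j)), (rev_ord (s k)), (rev_ord (s i)); rewrite !rciE /=.
  move: (ltn_ord i) (ltn_ord j) (ltn_ord k) (ltn_ord (s i)) (ltn_ord (s j)) (ltn_ord (s k)).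
  by split; lia.
have E (a : 'I_n) : exists2 b, a = rev_ord (s b) & rci s a = rev_ord b.
  exists (s^-1%g (rev_ord a)); rewrite ?permKV ?rev_ordK //.
  by rewrite -{1}[a]rev_ordK -{1}[rev_ord a](permKV s) rciE.
have [i' ei ri] := E i; have [j' ej rj] := E j; have [k' ek rk] := E k.
exists k', i', j'; move: ijk sijk; rewrite ri rj rk ei ej ek /=.
move: (ltn_ord i') (ltn_ord j') (ltn_ord k') (ltn_ord (s i')) (ltn_ord (s j')) (ltn_ord (s k')).
by split; lia.
Qed.

Lemma wilf_132_213 (m : nat) (st : m.-tuple perm_stat) :
  (forall n (s : 'S_n) i, tnth st i n (rci s) = tnth st i n s) ->
  wilf_equiv st p132 p213.
Proof.
exact: (@wilf_equiv_bij _ _ _ _ (fun n => @rci n) (@rci_inj) (@contains_rci)).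
Qed.

Lemma sum_permV (n : nat) (s : 'S_n) (F : 'I_n -> 'I_n -> nat) :
  \sum_i F i (s^-1%g i) = \sum_i F (s i) i.
Proof.
by rewrite (reindex_inj (@perm_inj _ s)); apply: eq_bigr => i _; rewrite permK.
Qed.

Lemma sum2_permV (n : nat) (s : 'S_n) (F : 'I_n -> 'I_n -> 'I_n -> 'I_n -> nat) :
  \sum_i \sum_j F i (s^-1%g i) j (s^-1%g j) = \sum_i \sum_j F (s i) i (s j) j.
Proof.
rewrite (sum_permV s (fun i a => \sum_j F i a j (s^-1%g j))).
by apply: eq_bigr => i _; rewrite (sum_permV s (fun j b => F (s i) i j b)).
Qed.

(** There are as many positions as values below [p], so as many arcs cross the cut at [p] upwards as
    downwards. *)
Lemma sum_perm_cut (n : nat) (s : 'S_n) (p : nat) :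
  \sum_(i < n) ((i < p) && (p <= s i)) = \sum_(i < n) ((p <= i) && (s i < p)).
Proof.
have e : \sum_(i < n) (s i < p) = \sum_(i < n) (i < p).
  by rewrite [RHS](reindex_inj (@perm_inj _ s)).
apply/eqP; rewrite -(eqn_add2l (\sum_(i < n) ((i < p) && (s i < p)))); apply/eqP.
rewrite -!big_split /=.
transitivity (\sum_(i < n) (i < p)); first by apply: eq_bigr => i _; lia.
by rewrite -e; apply: eq_bigr => i _; lia.
Qed.

Lemma fp_permV (n : nat) (s : 'S_n) : st_fp s^-1%g = st_fp s.
Proof.
rewrite /st_fp !card_set_sum (sum_permV s (fun i a => (a == i) : nat)).
by apply: eq_bigr => i _; rewrite eq_sym.
Qed.

Lemma inv_permV (n : nat) (s : 'S_n) : st_inv s^-1%g = st_inv s.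
Proof.
rewrite !st_invE.
rewrite (sum2_permV s (fun i a j b => (i < j) && (b < a) : nat)) exchange_big.
by apply: eq_bigr => i _; apply: eq_bigr => j _; rewrite andbC.
Qed.

(* Inversion exchanges the upper nestings with the strict lower ones; the
   remaining nestings have a fixed point below an arc, and a fixed point lies
   below as many upper arcs as lower arcs. *)
Lemma nes_permV (n : nat) (s : 'S_n) : st_nes s^-1%g = st_nes s.
Proof.
pose U (i a j b : 'I_n) : nat := [&& i < j, j < b & b < a].
pose L (i a j b : 'I_n) : nat := [&& b < a, a < i & i < j].
pose X (i a j b : 'I_n) : nat := [&& a == i, i < j & b < i].
have dec t : st_nes t = \sum_i \sum_j U i (t i) j (t j) +
    \sum_i \sum_j L i (t i) j (t j) + \sum_i \sum_j X i (t i) j (t j).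
  rewrite st_nesE -!big_split; apply: eq_bigr => i _.
  rewrite -!big_split; apply: eq_bigr => j _ /=; rewrite /nesting /U /L /X -val_eqE /=.
  lia.
rewrite !dec (sum2_permV s U) (sum2_permV s L) (sum2_permV s X); congr (_ + _).
  rewrite addnC; congr (_ + _); rewrite exchange_big /=;
  by apply: eq_bigr => i _; apply: eq_bigr => j _; rewrite /U /L.
apply: eq_bigr => i _; rewrite /X /=.
case: (eqVneq (s i) i) => [fi|nfi]; last first.
  by rewrite !big1.
rewrite fi /=.
have ns (j : 'I_n) : s j = i :> nat -> j = i.
  by move/val_inj => e; apply: (@perm_inj _ s); rewrite e fi.
transitivity (\sum_(j < n) ((j < i) && (i <= s j))).
  apply: eq_bigr => j _; have := ns j; case: (ltngtP (s j) i) => //; try lia.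
  by move=> e /(_ e)->; rewrite ltnn.
rewrite sum_perm_cut; apply: eq_bigr => j _.
case: (ltngtP i j) => //= e; rewrite (val_inj e : i = j) in fi *.
by rewrite fi ltnn.
Qed.

Lemma contains_permV (n : nat) (s : 'S_n) :
  contains p312 s^-1%g = contains p231 s.
Proof.
apply/contains312P/contains231P => -[i [j [k [ijk sijk]]]].
  exists (s^-1%g j), (s^-1%g k), (s^-1%g i); rewrite !permKV; split=> //; lia.
exists (s k), (s i), (s j); rewrite !permK; split=> //; lia.
Qed.

Lemma wilf_231_312 (m : nat) (st : m.-tuple perm_stat) :
  (forall n (s : 'S_n) i, tnth st i n s^-1%g = tnth st i n s) ->
  wilf_equiv st p231 p312.
Proof.
exact: (@wilf_equiv_bij _ _ _ _ (fun n (s : 'S_n) => s^-1%g)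
  (fun n => @invg_inj _) (@contains_permV)).
Qed.

(** * Inequivalence at n = 3 *)

Lemma ord3P (P : 'I_3 -> Prop) :
  P (inord 0) -> P (inord 1) -> P (inord 2) -> forall i, P i.
Proof.
move=> P0 P1 P2 [[|[|[|//]]] lt]; [move: P0|move: P1|move: P2];
by congr P; apply: val_inj; rewrite /= inordK.
Qed.

Lemma S3_bounds (s : 'S_3) : let v i := nat_of_ord (s (inord i)) in
  [/\ v 0 < 3, v 1 < 3, v 2 < 3 & [/\ v 0 != v 1, v 0 != v 2 & v 1 != v 2]].
Proof. by split=> //; apply: perm_neq3; rewrite !inordK. Qed.

Lemma S3_ext (s t : 'S_3) :
  s (inord 0) = t (inord 0) :> nat -> s (inord 1) = t (inord 1) :> nat ->
  s (inord 2) = t (inord 2) :> nat -> s = t.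
Proof. by move=> e0 e1 e2; apply/permP; apply: ord3P; apply: val_inj. Qed.

Lemma contains_S3 (s t : 'S_3) : contains t s = (s == t).
Proof.
apply/containsP/eqP => [[i [j [k [ijk]]]]|->]; last first.
  by exists (inord 0), (inord 1), (inord 2); rewrite !inordK.
have i0 : i = inord 0 by apply: val_inj; rewrite /= inordK //; move: (ltn_ord k); lia.
have j1 : j = inord 1 by apply: val_inj; rewrite /= inordK //; move: (ltn_ord k); lia.
have k2 : k = inord 2 by apply: val_inj; rewrite /= inordK //; move: (ltn_ord k); lia.
rewrite i0 j1 k2.
have [s0 s1 s2 [s01 s02 s12]] := S3_bounds s.
have [t0 t1 t2 [t01 t02 t12]] := S3_bounds t.
by move=> e1 e2 e3; apply: S3_ext; move: e1 e2 e3; lia.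
Qed.

(** At length 3 the generating polynomial of [u] is the sum of all monomials minus the monomial of
    [u]. Equal polynomials therefore give equal monomials, hence equal exponents. *)
Lemma wilf_equiv_stat (m : nat) (st : m.-tuple perm_stat) (s t : 'S_3) :
  wilf_equiv st s t -> forall i, tnth st i 3 s = tnth st i 3 t.
Proof.
move=> /(_ 3); rewrite /gen_poly.
pose mon (u : 'S_3) := [multinom tnth st i 3 u | i < m].
have E (u : 'S_3) : (\sum_(v in avoiders u 3) \prod_(i < m) 'X_i ^+ tnth st i 3 v =
   \sum_v 'X_[mon v] - 'X_[mon u] :> {mpoly int[m]})%R.
  rewrite [X in (X - _)%R](bigD1 u) //= [RHS]addrC addKr.
  apply: eq_big => [v|v _]; first by rewrite !inE contains_S3.
  by rewrite mpolyXE_id; apply: eq_bigr => i _; rewrite mnmE.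
rewrite !E => /addrI/oppr_inj/(congr1 (mcoeff (mon t))).
rewrite !mcoeffX eqxx; case: eqP => // e _ i.
by have := congr1 (fun k : 'X_{1..m} => k i) e; rewrite !mnmE.
Qed.

Lemma sum_ord3 (F : 'I_3 -> nat) : \sum_i F i = F (inord 0) + F (inord 1) + F (inord 2).
Proof.
rewrite !big_ord_recl big_ord0 addn0 addnA; congr (F _ + F _ + F _);
by apply: val_inj; rewrite /= inordK.
Qed.

Lemma fp_S3 (s : 'S_3) : st_fp s =
  (s (inord 0) == 0 :> nat) + (s (inord 1) == 1 :> nat) + (s (inord 2) == 2 :> nat).
Proof. by rewrite /st_fp card_set_sum sum_ord3 -!val_eqE /= !inordK. Qed.

Lemma inv_S3 (s : 'S_3) : st_inv s =
  (s (inord 1) < s (inord 0)) + (s (inord 2) < s (inord 0)) + (s (inord 2) < s (inord 1)).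
Proof. by rewrite st_invE !sum_ord3 !inordK //=; lia. Qed.

Lemma one_line3 (w : seq nat) (hw : perm_eq w (iota 1 3)) (i : nat) :
  i < 3 -> one_line hw (inord i) = (nth 0 w i).-1 :> nat.
Proof. by move=> i3; have := one_lineE hw (inord i); rewrite inordK // => <-. Qed.

Lemma S3_fp1 (s : 'S_3) : st_fp s = 1 -> s \in [set p132; p213; p321].
Proof.
rewrite fp_S3 !inE; have [s0 s1 s2 [s01 s02 s12]] := S3_bounds s => e.
have [e0|e1|e2] : [\/ s (inord 0) = 0 :> nat, s (inord 1) = 1 :> nat |
    s (inord 2) = 2 :> nat].
- by case: eqP e => [|_]; [constructor 1|case: eqP => [|_]; [constructor 2|constructor 3; lia]].
- suff -> : s = p132 by rewrite eqxx.
  by apply: S3_ext; rewrite one_line3 //=; lia.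
- suff -> : s = p321 by rewrite eqxx !orbT.
  by apply: S3_ext; rewrite one_line3 //=; lia.
suff -> : s = p213 by rewrite eqxx orbT.
by apply: S3_ext; rewrite one_line3 //=; lia.
Qed.

Lemma S3_fp0 (s : 'S_3) : st_fp s = 0 -> s \in [set p231; p312].
Proof.
rewrite fp_S3 !inE; have [s0 s1 s2 [s01 s02 s12]] := S3_bounds s => e.
have [e0|e0] : s (inord 0) = 1 :> nat \/ s (inord 0) = 2 :> nat by lia.
  suff -> : s = p231 by rewrite eqxx.
  by apply: S3_ext; rewrite one_line3 //=; lia.
suff -> : s = p312 by rewrite eqxx orbT.
by apply: S3_ext; rewrite one_line3 //=; lia.
Qed.

(** * Weighted Motzkin paths *)

Definition letter : Type := (bool * bool)%type.

Definition letters : seq letter :=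
  [:: (true, true); (true, false); (false, true); (false, false)].

Fixpoint words (n : nat) : seq (seq letter) :=
  if n is n'.+1 then [seq c :: w | c <- letters, w <- words n'] else [:: [::]].

Lemma wordsS (n : nat) :
  words n.+1 = [seq c :: w | c <- letters, w <- words n].
Proof. by []. Qed.

Lemma mem_words (n : nat) (w : seq letter) : (w \in words n) = (size w == n).
Proof.
elim: n w => [|n IH] [|c w] //.
  by apply/negbTE/negP; rewrite wordsS => /allpairsP[[c w] []].
rewrite wordsS [size _]/= eqSS -IH; apply/allpairsP/idP => [[[c' w'] [_ w'n [_ ->]]] //|wn].
by exists (c, w); split => //; case: c => [[] []].
Qed.

Lemma words_uniq (n : nat) : uniq (words n).
Proof. by elim: n => // n IH; rewrite wordsS allpairs_uniq // => -[c w] [c' w'] _ _ [-> ->]. Qed.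

Lemma big_words (V : nmodType) (n : nat) (F : seq letter -> V) :
  (\sum_(w <- words n.+1) F w = \sum_(w <- words n)
     (F ((true, true) :: w) + F ((true, false) :: w) +
      F ((false, true) :: w) + F ((false, false) :: w)))%R.
Proof.
rewrite [words n.+1]/= !big_cat !big_map big_nil /= Monoid.mulm1 !big_split /=.
by rewrite -!GRing.addrA.
Qed.

(* The weighted count of Motzkin paths with n steps from height 0 to height h;
   for h = 0 it is the n-th coefficient of the J-fraction with b_0 = x,
   b_h = t q^(h-1) + q^h and lambda_(h+1) = t q^(2h). *)
Fixpoint motzkin (R : comNzRingType) (x t q : R) (n h : nat) : R :=
  if n is n'.+1 then
    ((if h is h'.+1 then q ^+ h' * motzkin x t q n' h' +
       (t * q ^+ h' + q ^+ h) * motzkin x t q n' h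
      else x * motzkin x t q n' 0) + t * q ^+ h * motzkin x t q n' h.+1)%R
  else ((h == 0)%:R)%R.

(* A letter of the word of a permutation s avoiding 321 records whether p is an
   excedance position and whether p is an excedance value.  Words are stored
   with their last letter first, so that [height w] is the number of j < p with
   p <= s j, where p = size w. *)
Definition height (w : seq letter) : nat :=
  count (fun c : letter => c.1) w - count (fun c : letter => c.2) w.

Fixpoint motz_valid (w : seq letter) : bool :=
  if w is c :: w' then (c.2 ==> (0 < height w')) && motz_valid w' else true.

Fixpoint fpw (w : seq letter) : nat :=
  if w is c :: w' then [&& ~~ c.1, ~~ c.2 & height w' == 0] + fpw w' else 0.

(** The arcs over a point are counted there as crossings; if the point is an excedance value, the
    arc ending at it is left out. *)
Fixpoint crsw (w : seq letter) : nat :=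
  if w is c :: w' then (height w' - c.2) + crsw w' else 0.

Definition excw (w : seq letter) : nat := count (fun c : letter => c.2) w.

Lemma motz_valid_le (w : seq letter) : motz_valid w ->
  count (fun c : letter => c.2) w <= count (fun c : letter => c.1) w.
Proof.
elim: w => //= c w IH /andP[h /IH le]; move: h; rewrite /height.
by case: c => [[] []] /=; lia.
Qed.

Lemma height_cons (c : letter) (w : seq letter) : motz_valid (c :: w) ->
  height (c :: w) + c.2 = height w + c.1.
Proof.
move=> /andP[h /motz_valid_le le]; move: h; rewrite /height /=.
by case: c => [[] []] /=; lia.
Qed.

Lemma sum_motz_valid (R : comNzRingType) (x t q : R) (n h : nat) :
  (\sum_(w <- words n | motz_valid w && (height w == h))
     x ^+ fpw w * t ^+ excw w * q ^+ crsw w = motzkin x t q n h)%R.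
Proof.
pose f w := (x ^+ fpw w * t ^+ excw w * q ^+ crsw w)%R.
pose b (w : seq letter) (k : nat) : R := ((motz_valid w && (height w == k))%:R)%R.
suff : (\sum_(w <- words n) b w h * f w = motzkin x t q n h)%R.
  move=> <-; rewrite big_mkcond; apply: eq_bigr => w _; rewrite /b /f.
  by case: ifP; rewrite ?mul1r ?mul0r.
elim: n h => [|n IH] h.
  by rewrite big_seq1 /b /f /= /height /excw /= !expr0 !mulr1 eq_sym.
rewrite big_words.
(* The height equation is additive, which avoids truncated subtraction. *)
have bE w c k : b (c :: w) k =
    (((c.2 ==> (0 < height w)) && motz_valid w && (height w + c.1 == k + c.2))%N%:R)%R.
  rewrite /b; case: (boolP (motz_valid (c :: w))) => /= [vw|/negbTE -> //].
  have /andP[-> ->] := vw; congr (_%:R)%R; congr (nat_of_bool _).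
  by rewrite -(height_cons vw) /= eqn_add2r.
(* The predecessor at height 0 does no harm: [bE] gives weight 0 to a letter with [c.2] there. *)
have fE w c : f (c :: w) = ((if c.2 then t * q ^+ (height w).-1 else
    if ~~ c.1 && (height w == 0) then x else q ^+ height w) * f w)%R.
  rewrite /f /= /excw /=; case: c => [[] []] /=; rewrite ?subn0 ?subn1 ?add0n ?add1n ?exprD ?exprS.
  - by ring.
  - by ring.
  - by ring.
  case: eqP => [->|_]; rewrite ?add1n ?add0n ?exprS ?expr0; by ring.
case: h => [|h] /=.
- rewrite -!IH !mulr_sumr -big_split; apply: eq_big_seq => w _ /=.
  rewrite !bE !fE /b /=; case: (motz_valid w); rewrite ?andbF ?mul0r ?mulr0 ?addr0 //=.
  case: (height w) => [|[|k]] //=; rewrite ?expr0 ?expr1; ring.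
rewrite mulrDl -!IH !mulr_sumr -!big_split; apply: eq_big_seq => w _ /=.
rewrite !bE !fE /b /=; case: (motz_valid w); rewrite ?andbF ?mul0r ?mulr0 ?addr0 //=.
case: (height w) => [|k] /=.
  rewrite ?addn0 ?addn1 /=; case: h => [|h] /=; rewrite ?expr0; ring.
rewrite !addn0 !addn1 /= !eqSS.
have sub1 (i j : nat) (y : R) :
    ((i == j)%N%:R * (q ^+ i * y) = q ^+ j * ((i == j)%N%:R * y))%R.
  by case: eqP => [->|_]; rewrite ?mul0r ?mulr0 ?mul1r.
have sub2 (i j : nat) (y : R) :
    ((i == j)%N%:R * (t * q ^+ i * y) = t * q ^+ j * ((i == j)%N%:R * y))%R.
  by rewrite -!mulrA mulrCA sub1.
have sub3 (y : R) : ((k == h)%N%:R * (q ^+ k.+1 * y) = q ^+ h.+1 * ((k == h)%N%:R * y))%R.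
  by rewrite -eqSS sub1.
rewrite !sub2 sub1 sub3; ring.
Qed.

(** * Permutations avoiding 321 *)

Fixpoint cnt (Q : pred nat) (p : nat) : nat :=
  if p is p'.+1 then cnt Q p' + Q p' else 0.

Lemma leq_cnt (Q : pred nat) (p r : nat) : p <= r -> cnt Q p <= cnt Q r.
Proof.
move=> /subnK <-; elim: (r - p) => // d; rewrite addSn /=; lia.
Qed.

Lemma ltn_cnt (Q : pred nat) (p r : nat) : Q p -> p < r -> cnt Q p < cnt Q r.
Proof. by move=> Qp /(leq_cnt Q); rewrite /= Qp addn1. Qed.

Lemma cnt_inj (Q : pred nat) (p r : nat) : Q p -> Q r -> cnt Q p = cnt Q r -> p = r.
Proof.
move=> Qp Qr e; case: (ltngtP p r) => // h.
  by have := ltn_cnt Qp h; rewrite e ltnn.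
by have := ltn_cnt Qr h; rewrite e ltnn.
Qed.

Lemma cntC (Q : pred nat) (p : nat) : cnt Q p + cnt (predC Q) p = p.
Proof. elim: p => //= p IH; case: (Q p) => /=; lia. Qed.

Lemma cnt_rank (Q : pred nat) (n k : nat) : k < cnt Q n ->
  exists v, [/\ v < n, Q v & cnt Q v = k].
Proof.
elim: n => //= n IH; case: (ltnP k (cnt Q n)) => [/IH[v [vn Qv e]] _|h1 h2].
  by exists v; split=> //; apply: ltnW.
exists n; move: h2; case: (Q n) => h2; split=> //; lia.
Qed.

Lemma cnt_sum (n : nat) (Q : pred nat) (p : nat) : p <= n ->
  cnt Q p = \sum_(i < n) (Q i && (i < p)).
Proof.
move=> pn; have -> : cnt Q p = \sum_(i < p) Q i.
  by elim: p {pn} => [|p IH]; rewrite ?big_ord0 // big_ord_recr /= -IH.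
rewrite (big_ord_widen _ (fun i => nat_of_bool (Q i)) pn) big_mkcond.
by apply: eq_bigr => i _; case: (i < p); rewrite ?andbT ?andbF.
Qed.

Lemma eq_cnt (P Q : pred nat) (p : nat) :
  (forall i, i < p -> P i = Q i) -> cnt P p = cnt Q p.
Proof.
elim: p => //= p IH e; rewrite e // IH // => i ip; apply: e; exact: ltnW.
Qed.

Fixpoint word_of (f : nat -> letter) (n : nat) : seq letter :=
  if n is n'.+1 then f n' :: word_of f n' else [::].

Lemma size_word_of (f : nat -> letter) (n : nat) : size (word_of f n) = n.
Proof. by elim: n => //= n ->. Qed.

Lemma word_of_inj (f g : nat -> letter) (n : nat) :
  word_of f n = word_of g n -> forall p, p < n -> f p = g p.
Proof.
elim: n => //= n IH [e /IH{}IH] p; rewrite ltnS leq_eqVlt => /predU1P[-> //|].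
exact: IH.
Qed.

Lemma eq_word_of (f g : nat -> letter) (n : nat) :
  (forall p, p < n -> f p = g p) -> word_of f n = word_of g n.
Proof. by elim: n => //= n IH e; rewrite e // IH // => p pn; apply/e/ltnW. Qed.

Lemma word_of_surj (w : seq letter) : exists f, w = word_of f (size w).
Proof.
elim: w => [|c w [f e]]; first by exists (fun=> (true, true)).
exists (fun p => if p == size w then c else f p); rewrite /= eqxx; congr (_ :: _).
by rewrite {1}e; apply: eq_word_of => p pn; rewrite ltn_eqF.
Qed.

Lemma count_word_of (f : nat -> letter) (Q : pred letter) (n : nat) :
  count Q (word_of f n) = cnt (fun p => Q (f p)) n.
Proof. by elim: n => //= n ->; rewrite addnC. Qed.

Lemma height_word_of (f : nat -> letter) (n : nat) : height (word_of f n) =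
  cnt (fun p => (f p).1) n - cnt (fun p => (f p).2) n.
Proof. by rewrite /height !count_word_of. Qed.

Lemma motz_valid_word_of (f : nat -> letter) (n : nat) :
  motz_valid (word_of f n) <->
  (forall p, p < n -> (f p).2 ->
     cnt (fun p => (f p).2) p < cnt (fun p => (f p).1) p).
Proof.
elim: n => [|n IH] //; split=> [/= /andP[h /IH{}IH] p|h].
  rewrite ltnS leq_eqVlt => /predU1P[->|]; last exact: IH.
  by move=> f2; move: h; rewrite f2 /= height_word_of subn_gt0.
apply/andP; split; last by apply/IH => p pn; apply/h/ltnW.
by apply/implyP => /h; rewrite height_word_of subn_gt0; apply.
Qed.

Lemma motz_valid_cnt (f : nat -> letter) (n p : nat) :
  motz_valid (word_of f n) -> p <= n ->
  cnt (fun p => (f p).2) p <= cnt (fun p => (f p).1) p.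
Proof.
move=> /motz_valid_word_of v; elim: p => //= p IH pn.
have := IH (ltnW pn); have := v p pn; case: (f p) => [[] []] /=; lia.
Qed.

Lemma fpw_word_of (f : nat -> letter) (n : nat) : fpw (word_of f n) =
  \sum_(p < n) [&& ~~ (f p).1, ~~ (f p).2 & height (word_of f p) == 0].
Proof. by elim: n => [|n IH]; rewrite ?big_ord0 // big_ord_recr /= IH addnC. Qed.

Lemma crsw_word_of (f : nat -> letter) (n : nat) : crsw (word_of f n) =
  \sum_(p < n) (height (word_of f p) - (f p).2).
Proof. by elim: n => [|n IH]; rewrite ?big_ord0 // big_ord_recr /= IH addnC. Qed.

Definition exc_letter (n : nat) (s : 'S_n) (p : nat) : letter :=
  if (insub p : option 'I_n) is Some i then (i < s i, s^-1%g i < i) else (false, false).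

Definition exc_word (n : nat) (s : 'S_n) : seq letter := word_of (exc_letter s) n.

Lemma exc_letterE (n : nat) (s : 'S_n) (i : 'I_n) :
  exc_letter s i = (i < s i, s^-1%g i < i).
Proof. by rewrite /exc_letter valK. Qed.

Definition arcs_over (n : nat) (s : 'S_n) (p : nat) : nat :=
  \sum_(i < n) ((i < p) && (p <= s i)).

(** Excedances before [p] split into those whose value is already below [p], which cancel against
    the excedance values, and those still open. *)
Lemma height_exc_word (n : nat) (s : 'S_n) (p : nat) : p <= n ->
  height (word_of (exc_letter s) p) = arcs_over s p.
Proof.
move=> pn; rewrite height_word_of !(cnt_sum _ pn).
have -> : \sum_(i < n) ((exc_letter s i).2 && (i < p)) =
    \sum_(i < n) ((i < s i) && (s i < p)).
  rewrite (reindex_inj (@perm_inj _ s)); apply: eq_bigr => i _.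
  by rewrite exc_letterE permK.
have -> : \sum_(i < n) ((exc_letter s i).1 && (i < p)) =
    \sum_(i < n) ((i < s i) && (s i < p)) + arcs_over s p.
  rewrite -big_split; apply: eq_bigr => i _; rewrite exc_letterE /=; lia.
by rewrite addKn.
Qed.

Lemma arcs_overP (n : nat) (s : 'S_n) (p : nat) :
  reflect (exists i : 'I_n, i < p <= s i) (0 < arcs_over s p).
Proof.
rewrite lt0n sum_nat_eq0; apply: (iffP forallPn) => -[i h]; exists i; move: h; lia.
Qed.

Lemma arcs_overP' (n : nat) (s : 'S_n) (p : nat) :
  reflect (exists i : 'I_n, s i < p <= i) (0 < arcs_over s p).
Proof.
rewrite /arcs_over sum_perm_cut lt0n sum_nat_eq0.
by apply: (iffP forallPn) => -[i h]; exists i; move: h; lia.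
Qed.

Lemma exc_word_valid (n : nat) (s : 'S_n) : motz_valid (exc_word s).
Proof.
apply/motz_valid_word_of => p pn.
rewrite -subn_gt0 -height_word_of height_exc_word ?(ltnW pn) //.
have -> : p = Ordinal pn by [].
rewrite exc_letterE /= => h; apply/arcs_overP; exists (s^-1%g (Ordinal pn)).
by rewrite permKV /= h leqnn.
Qed.

Lemma exc_word_height (n : nat) (s : 'S_n) : height (exc_word s) = 0.
Proof.
rewrite height_exc_word // /arcs_over big1 // => i _.
by rewrite ltn_ord leqNgt ltn_ord.
Qed.

Lemma excw_exc_word (n : nat) (s : 'S_n) : excw (exc_word s) = st_exc s.
Proof.
rewrite /excw count_word_of (@cnt_sum n) // /st_exc card_set_sum.
rewrite (reindex_inj (@perm_inj _ s)); apply: eq_bigr => i _.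
by rewrite exc_letterE permK ltn_ord andbT.
Qed.

Section Avoid321.

Variables (n : nat) (s : 'S_n).
Hypothesis av : ~~ contains p321 s.

Let av321 (i j k : 'I_n) : i < j < k -> s k < s j < s i -> False.
Proof. by move=> h1 h2; apply/(negP av)/contains321P; exists i, j, k. Qed.

Let s_neq (i j : 'I_n) : i != j :> nat -> s i != s j :> nat.
Proof. by apply: contra => /eqP/val_inj/perm_inj->. Qed.

(** The excedance at [j] crosses the cut just after [j] upwards, so some later [k] crosses it
    downwards. If [s j < s i], then [i], [j], [k] form a 321. *)
Lemma av321_exc (i j : 'I_n) : i < j -> j < s j -> s i < s j.
Proof.
move=> ij ej; rewrite ltnNge; apply/negP => ji.
have [|k kj] := arcs_overP' s j.+1 _; first by apply/arcs_overP; exists j; rewrite ltnSn.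
apply: (@av321 i j k); first lia.
have : s i != s j :> nat by apply: s_neq; lia.
lia.
Qed.

(** Dually, if [s j < s i] then [j] crosses the cut at [s i] downwards, and an arc crossing it
    upwards supplies the first entry of a 321. *)
Lemma av321_nexc (i j : 'I_n) : i < j -> s i <= i -> s i < s j.
Proof.
move=> ij ei; rewrite ltnNge; apply/negP => ji.
have sij : s i != s j :> nat by apply: s_neq; lia.
have [|k kj] := arcs_overP s (s i) _; first by apply/arcs_overP'; exists j; lia.
apply: (@av321 k i j); first lia.
have : s k != s i :> nat by apply: s_neq; lia.
lia.
Qed.

(** A fixed point under an arc also has an arc passing it downwards, and would be the middle entry
    of a 321. *)
Lemma fpw_exc_word : fpw (exc_word s) = st_fp s.
Proof.
rewrite fpw_word_of /st_fp card_set_sum; apply: eq_bigr => p _.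
rewrite exc_letterE height_exc_word ?(ltnW (ltn_ord _)) //= -val_eqE /=.
congr nat_of_bool; apply/idP/idP => [/and3P[h1 h2 /eqP h3]|/eqP h].
  case: (ltngtP (s p) p) h1 => // h _.
  by have : 0 < arcs_over s p by [apply/arcs_overP'; exists p; rewrite h leqnn]; rewrite h3.
have h' : s p = p by apply: val_inj.
rewrite h' ltnn -{1}h' permK ltnn /= eqn0Ngt; apply/negP => h0.
have /arcs_overP[i hi] := h0; have /arcs_overP'[j hj] := h0.
have nj : p != j :> nat.
  by apply/eqP => /val_inj e; move: hj; rewrite -e h' ltnn.
have ni : s i != s p :> nat by apply: s_neq; lia.
by apply: (@av321 i p j); move: ni; rewrite h'; lia.
Qed.

(** An upper crossing is charged to the value of its left arc, a lower one to the value of its right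
    arc. By avoidance, every arc passing the value [s i], other than the arc of [i] itself, gives
    such a crossing; for a non-excedance the arcs are counted downwards through the cut. *)
Lemma crsw_exc_word : crsw (exc_word s) = st_crs s.
Proof.
rewrite crsw_word_of st_crsE.
pose up (i j : 'I_n) : nat := [&& i < j, j < s i & s i < s j].
pose lo (i j : 'I_n) : nat := [&& s i < s j, s j <= i & i < j].
have -> : \sum_i \sum_j crossing s i j = \sum_i \sum_j (up i j + lo j i).
  transitivity (\sum_i \sum_j (up i j + lo i j)).
    by apply: eq_bigr => i _; apply: eq_bigr => j _; rewrite /crossing /up /lo; lia.
  under eq_bigr do rewrite big_split; under [RHS]eq_bigr do rewrite big_split.
  by rewrite !big_split; congr (_ + _); rewrite exchange_big.
rewrite (reindex_inj (@perm_inj _ s)); apply: eq_bigr => i _ /=.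
rewrite exc_letterE permK height_exc_word ?(ltnW (ltn_ord _)) //=.
case: (ltnP i (s i)) => ei; last first.
  rewrite subn0 /arcs_over sum_perm_cut; apply: eq_bigr => j _.
  have := @av321_nexc i j; have : j != i :> nat -> s j != s i :> nat by exact: s_neq.
  rewrite /up /lo; have [->|] := eqVneq j i; first by lia.
  by rewrite -val_eqE /=; lia.
rewrite /arcs_over (bigD1 i) //= [RHS](bigD1 i) //= ei leqnn addKn.
rewrite {1}/up {1}/lo !ltnn !andbF /=; apply: eq_bigr => j nji.
have := @av321_exc j i; rewrite -val_eqE in nji; have := s_neq nji.
by rewrite /up /lo; move: nji; rewrite /=; lia.
Qed.

(** Avoidance makes [s] increasing on the excedances and on the remaining positions, so it preserves
    ranks within each class. This is why the word determines [s]. *)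
Lemma exc_rank (i : 'I_n) (b := i < s i) :
  cnt (fun v => (exc_letter s v).2 == b) (s i) =
  cnt (fun p => (exc_letter s p).1 == b) i.
Proof.
rewrite !(@cnt_sum n) ?(ltnW (ltn_ord _)) // (reindex_inj (@perm_inj _ s)).
apply: eq_bigr => j _ /=; rewrite !exc_letterE permK /=; congr nat_of_bool.
case: eqP => //= ej; rewrite /b in ej.
have [->|] := eqVneq j i; first by rewrite !ltnn.
rewrite -val_eqE /= => nji; have := s_neq nji.
have := @av321_exc i j; have := @av321_exc j i.
have := @av321_nexc i j; have := @av321_nexc j i; move: ej.
by case: (ltngtP i j) nji => //=; lia.
Qed.

End Avoid321.

Lemma exc_word_inj (n : nat) (s s' : 'S_n) :
  ~~ contains p321 s -> ~~ contains p321 s' -> exc_word s = exc_word s' -> s = s'.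
Proof.
move=> av av' /word_of_inj e; apply/permP => i; apply: val_inj.
have e1 : (i < s i) = (i < s' i).
  by have := e i (ltn_ord i); rewrite !exc_letterE => -[].
apply: (@cnt_inj (fun v => (exc_letter s v).2 == (i < s i))) => /=.
- by rewrite exc_letterE permK.
- by rewrite e // exc_letterE permK e1.
rewrite exc_rank //; transitivity (cnt (fun p => (exc_letter s' p).1 == (i < s' i)) i).
  by apply: eq_cnt => p pi; rewrite e ?e1 //; apply: ltn_trans pi (ltn_ord i).
rewrite -exc_rank //; apply: eq_cnt => p pi; rewrite e ?e1 //.
exact: ltn_trans pi (ltn_ord _).
Qed.

(* The permutation matches the k-th excedance position with the k-th excedance
   value, and the k-th remaining position with the k-th remaining value. *)
Lemma exc_word_surj (n : nat) (w : seq letter) :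
  size w = n -> motz_valid w -> height w = 0 ->
  exists2 s : 'S_n, ~~ contains p321 s & exc_word s = w.
Proof.
have [f ew] := word_of_surj w => sw; rewrite ew sw => vw hw.
have le p : p <= n -> cnt (fun p => (f p).2) p <= cnt (fun p => (f p).1) p.
  exact: motz_valid_cnt vw.
have lt p : p < n -> (f p).2 ->
    cnt (fun p => (f p).2) p < cnt (fun p => (f p).1) p.
  by move/motz_valid_word_of: vw; apply.
pose P b (p : nat) := (f p).1 == b; pose Q b (p : nat) := (f p).2 == b.
have PT p : cnt (P true) p = cnt (fun p => (f p).1) p.
  by apply: eq_cnt => i _; rewrite /P; case: (f i).1.
have QT p : cnt (Q true) p = cnt (fun p => (f p).2) p.
  by apply: eq_cnt => i _; rewrite /Q; case: (f i).2.
have PF p : cnt (P true) p + cnt (P false) p = p.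
  rewrite -[RHS](cntC (P true)); congr (_ + _).
  by apply: eq_cnt => i _; rewrite /P /=; case: (f i).1.
have QF p : cnt (Q true) p + cnt (Q false) p = p.
  rewrite -[RHS](cntC (Q true)); congr (_ + _).
  by apply: eq_cnt => i _; rewrite /Q /=; case: (f i).2.
(* Final height 0 makes the two classes of positions as large as the two classes of values. *)
have PQ b : cnt (P b) n = cnt (Q b) n.
  have eT : cnt (P true) n = cnt (Q true) n.
    by rewrite PT QT; move: hw (le n (leqnn n)); rewrite height_word_of; lia.
  by case: b => //; move: (PF n) (QF n); lia.
have ex (i : 'I_n) : exists v : 'I_n, ((f v).2 == (f i).1) &&
    (cnt (Q (f i).1) v == cnt (P (f i).1) i).
  have [|v [vn Qv cv]] := @cnt_rank (Q (f i).1) n (cnt (P (f i).1) i).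
    by rewrite -PQ; apply: ltn_cnt; rewrite ?ltn_ord // /P.
  by exists (Ordinal vn); rewrite /= cv eqxx andbT.
pose g (i : 'I_n) : 'I_n := xchoose (ex i).
have g1 (i : 'I_n) : (f (g i)).2 = (f i).1 by have /andP[/eqP] := xchooseP (ex i).
have g2 (i : 'I_n) : cnt (Q (f i).1) (g i) = cnt (P (f i).1) i.
  by have /andP[_ /eqP] := xchooseP (ex i).
have g_inj : injective g.
  move=> i j e; apply: val_inj; have eP : (f i).1 = (f j).1 by rewrite -!g1 e.
  apply: (@cnt_inj (P (f i).1)); rewrite /P ?eP //.
  by rewrite -[in LHS]eP -g2 e eP g2.
have [s sE] : exists s : 'S_n, forall i, s i = g i.
  by exists (perm g_inj) => i; rewrite permE.
(* Validity puts strictly fewer excedance values than excedance positions before an excedance value,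
   and never more before any point. With equal ranks this forces [g i] beyond [i] in the first class
   and not beyond it in the second. *)
have excE (i : 'I_n) : (i < s i) = (f i).1.
  rewrite sE; have := g1 i; have := g2 i; case fi: (f i).1 => e2 e1.
    rewrite ltnNge; apply/negP => gi; have := lt (g i) (ltn_ord _) e1.
    by have := leq_cnt (P true) gi; rewrite -PT -QT -e2; lia.
  apply/negbTE; rewrite -leqNgt leqNgt; apply/negP => ig.
  have Pi : P false i by rewrite /P fi.
  have := ltn_cnt Pi ig; have := le (g i) (ltnW (ltn_ord _)).
  by have := PF (g i); have := QF (g i); rewrite -PT -QT -e2; lia.
have mono (i j : 'I_n) : i < j -> (f i).1 = (f j).1 -> s i < s j.
  move=> ij e; rewrite !sE ltnNge; apply/negP => gji.
  have Pi : P (f i).1 i by rewrite /P.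
  by have := ltn_cnt Pi ij; have := leq_cnt (Q (f i).1) gji; rewrite g2 e g2; lia.
exists s.
  apply/contains321P => -[i [j [k [/andP[ij jk] sijk]]]].
  (* Two of the three entries lie in the same class, on which [s] increases. *)
  have [e|e|e] : [\/ (f i).1 = (f j).1, (f j).1 = (f k).1 | (f i).1 = (f k).1].
  - case: (f i).1; case: (f j).1; case: (f k).1;
    by [constructor 1 | constructor 2 | constructor 3].
  - by have := mono i j ij e; lia.
  - by have := mono j k jk e; lia.
  by have := mono i k (ltn_trans ij jk) e; lia.
apply: eq_word_of => p pn; have -> : p = Ordinal pn by [].
rewrite exc_letterE excE; have -> : s^-1%g (Ordinal pn) < Ordinal pn = (f (Ordinal pn)).2.
  by have := excE (s^-1%g (Ordinal pn)); rewrite permKV => ->; rewrite -g1 -sE permKV.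
by case: (f _).
Qed.

Lemma sum_av321 (R : comNzRingType) (x t q : R) (n : nat) :
  (\sum_(s in avoiders p321 n) x ^+ st_fp s * t ^+ st_exc s * q ^+ st_crs s =
   motzkin x t q n 0)%R.
Proof.
rewrite -sum_motz_valid -[RHS]big_filter -[LHS]big_enum /=.
apply: (@big_rel _ _ _ _ _ (fun s w => ~~ contains p321 s /\ w = exc_word s)).
- exact: enum_uniq.
- by rewrite filter_uniq // words_uniq.
- move=> s; rewrite mem_enum inE => av; exists (exc_word s) => //.
  by rewrite mem_filter exc_word_valid exc_word_height eqxx mem_words size_word_of /=.
- move=> w; rewrite mem_filter mem_words => /andP[/andP[vw /eqP hw] /eqP sw].
  by have [s av e] := exc_word_surj sw vw hw; exists s; rewrite ?mem_enum ?inE.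
- by move=> s w w' [_ ->] [_ ->].
- by move=> s s' w [av ->] [av']; apply: exc_word_inj.
by move=> s w _ _ [av ->]; rewrite fpw_exc_word // crsw_exc_word // excw_exc_word.
Qed.

(** * Walks in the bicyclic monoid *)

(* The bicyclic monoid: (a, b) stands for the lattice path with a down steps
   followed by b up steps, the normal form of a path after the cancellation of
   its matched steps (true is an up step). *)
Definition bmul (u v : nat * nat) : nat * nat :=
  (u.1 + (v.1 - u.2), v.2 + (u.2 - v.1)).

Definition bgen (c : bool) : nat * nat := if c then (0, 1) else (1, 0).

Fixpoint bst (w : seq bool) : nat * nat :=
  if w is c :: w' then bmul (bgen c) (bst w') else (0, 0).

Lemma bmulA (u v w : nat * nat) : bmul u (bmul v w) = bmul (bmul u v) w.
Proof. case: u v w => [a b] [c d] [e f]; rewrite /bmul /=; congr pair; lia. Qed.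

Lemma bmul1 (u : nat * nat) : bmul u (0, 0) = u.
Proof. by case: u => a b; rewrite /bmul /= addn0 subn0. Qed.

Lemma bst_cat (w1 w2 : seq bool) : bst (w1 ++ w2) = bmul (bst w1) (bst w2).
Proof.
elim: w1 => [|c w1 IH] /=; last by rewrite IH bmulA.
by case: (bst w2) => a b; rewrite /bmul /= subn0 addn0.
Qed.

(* The path read outwards from its middle: the head of the word is the pair
   made of the first and the last step. *)
Fixpoint unfold_path (w : seq letter) : seq bool :=
  if w is c :: w' then c.1 :: rcons (unfold_path w') c.2 else [::].

Definition mst (w : seq letter) : nat * nat := bst (unfold_path w).

Lemma mst_cons (c : letter) (w : seq letter) :
  mst (c :: w) = bmul (bmul (bgen c.1) (mst w)) (bgen c.2).
Proof. by rewrite /mst /= -cats1 bst_cat /= bmul1 bmulA. Qed.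

Lemma mst_even (w : seq letter) : ~~ odd ((mst w).1 + (mst w).2).
Proof.
elim: w => [|c w] //; rewrite mst_cons; case: (mst w) => a b.
by case: c => [[] []]; rewrite /bmul /=; lia.
Qed.

(** A new first step that goes up and meets an unmatched down step of the inner path is paired with
    it, giving a pair centred left of the middle line: an excedance. *)
Fixpoint excm (w : seq letter) : nat :=
  if w is c :: w' then (c.1 && (0 < (mst w').1)) + excm w' else 0.

(** At state [(0, 0)] an outer up step and an outer down step are paired with each other, so their
    pair is centred on the middle line. *)
Fixpoint fpm (w : seq letter) : nat :=
  if w is c :: w' then [&& c.1, ~~ c.2 & mst w' == (0, 0)] + fpm w' else 0.

Fixpoint crsm (w : seq letter) : nat :=
  if w is c :: w' then
    (((mst w').1 + (mst w').2)./2 - (c.1 && (0 < (mst w').1))) + crsm w'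
  else 0.

Lemma motzkin_eq0 (R : comNzRingType) (x t q : R) (n h : nat) :
  n < h -> motzkin x t q n h = 0%R.
Proof.
elim: n h => [|n IH] [|h] //= nh.
by rewrite !IH ?mulr0 ?addr0 //; lia.
Qed.

Section WalkSum.

Variables (R : comNzRingType) (x t q : R).
Local Open Scope ring_scope.

Let lw (c : letter) (u : nat * nat) : R :=
  if [&& c.1, ~~ c.2 & u == (0, 0)%N] then x else
  if c.1 && (0 < u.1)%N then t * q ^+ ((u.1 + u.2)./2).-1 else q ^+ (u.1 + u.2)./2.

Let wt (w : seq letter) : R := x ^+ fpm w * t ^+ excm w * q ^+ crsm w.

Let wt_cons c w : wt (c :: w) = lw c (mst w) * wt w.
Proof.
rewrite /wt /lw /=; case: (mst w) => a b /=.
case: (boolP [&& c.1, ~~ c.2 & _]) => [/and3P[-> _ /eqP[-> ->]]|_] /=.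
  by rewrite add1n !add0n exprS; ring.
case: (c.1 && (0 < a)%N) => /=; rewrite ?add1n ?add0n ?subn1 ?subn0 ?exprS ?exprD; ring.
Qed.

Let step (c : letter) (u : nat * nat) := bmul (bmul (bgen c.1) u) (bgen c.2).

(** One step of the walk, acting on test functions instead of distributions. *)
Let push (phi : nat * nat -> R) (u : nat * nat) : R :=
  lw (true, true) u * phi (step (true, true) u) +
  lw (true, false) u * phi (step (true, false) u) +
  lw (false, true) u * phi (step (false, true) u) +
  lw (false, false) u * phi (step (false, false) u).

Let diag (phi : nat * nat -> R) (h : nat) : R :=
  \sum_(a < h.*2.+1) phi (val a, h.*2 - a)%N.

(** The two end terms can be peeled off at the start, at the end, or one on each side. This matches
    the index shifts that the four steps cause along an antidiagonal. *)
Let diag_recll phi h :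
  diag phi h.+1 = phi (0, h.*2.+2)%N + phi (1, h.*2.+1)%N +
    \sum_(a < h.*2.+1) phi (a.+2, h.*2 - a)%N.
Proof.
rewrite /diag doubleS 2!big_ord_recl /= addrA; congr (_ + _ + _).
Qed.

Let diag_recrr phi h :
  diag phi h.+1 = \sum_(a < h.*2.+1) phi (val a, h.*2.+2 - a)%N +
    phi (h.*2.+1, 1)%N + phi (h.*2.+2, 0)%N.
Proof.
by rewrite /diag doubleS 2!big_ord_recr /= subnn subSnn.
Qed.

Let diag_reclr phi h :
  diag phi h.+1 = phi (0, h.*2.+2)%N +
    (\sum_(a < h.*2.+1) phi (a.+1, h.*2.+1 - a)%N + phi (h.*2.+2, 0)%N).
Proof.
by rewrite /diag doubleS big_ord_recl big_ord_recr /= /bump /= add1n subnn.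
Qed.

Let lwT b2 a b h : (a.+1 + b = h.+1.*2)%N -> lw (true, b2) (a.+1, b) = t * q ^+ h.
Proof. by move=> e; rewrite /lw e doubleK [_ == _]/= !andbF. Qed.

Let lwT0 b2 b h : (b = h.+1.*2)%N -> lw (true, b2) (0, b)%N = q ^+ h.+1.
Proof. by move=> ->; rewrite /lw [(_, _).1]/= add0n doubleK [_ == _]/= !andbF. Qed.

Let lwF b2 a b h : (a + b = h.*2)%N -> lw (false, b2) (a, b) = q ^+ h.
Proof. by move=> e; rewrite /lw e doubleK. Qed.

(* The uniform distribution on each antidiagonal is preserved by the walk. *)
Let diag_push phi h : diag (push phi) h =
  q ^+ h * diag phi h.+1 +
  (if h is h'.+1 then (t * q ^+ h' + q ^+ h) * diag phi h + t * q ^+ h' * diag phi h'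
   else x * diag phi 0).
Proof.
case: h => [|h].
  rewrite diag_recll /diag !big_ord_recl !big_ord0 /push /lw /step /bmul /=.
  by rewrite !expr0; ring.
(* The states with no down step or no up step are set apart, since there an added step finds nothing
   to cancel. *)
rewrite {1}diag_reclr.
have inner (a : 'I_h.*2.+1) : push phi (a.+1, h.*2.+1 - a)%N =
    q ^+ h.+1 * phi (a.+2, h.*2.+2 - a)%N + q ^+ h.+1 * phi (a.+2, h.*2 - a)%N +
    t * q ^+ h * phi (val a, h.*2.+2 - a)%N + t * q ^+ h * phi (val a, h.*2 - a)%N.
  have := ltn_ord a; rewrite ltnS => ah.
  have e1 : (h.*2.+1 - a = (h.*2 - a).+1)%N by lia.
  have e2 : (h.*2.+2 - a = (h.*2 - a).+2)%N by lia.
  have e3 : (a.+1 + (h.*2 - a).+1 = h.+1.*2)%N by lia.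
  rewrite e1 e2 /push !(lwT _ e3) !(lwF _ e3) /step /bmul /=.
  rewrite !(subn0, addn0, add0n, subn1, addn1, add1n, subSS, sub0n) /=.
  ring.
rewrite (eq_bigr _ (fun a _ => inner a)) !big_split /= -!mulr_sumr.
have -> : push phi (0, h.*2.+2)%N = q ^+ h.+1 * (phi (1, h.*2.+3)%N +
    phi (1, h.*2.+1)%N + phi (0, h.*2.+4)%N + phi (0, h.*2.+2)%N).
  have e : (0 + h.*2.+2 = h.+1.*2)%N by rewrite add0n doubleS.
  rewrite /push !(lwT0 _ (esym (doubleS h))) !(lwF _ e) /step /bmul /=.
  rewrite !(subn0, addn0, add0n, subn1, addn1, add1n, subSS, sub0n) /=.
  ring.
have -> : push phi (h.*2.+2, 0)%N =
    q ^+ h.+1 * (phi (h.*2.+3, 1)%N + phi (h.*2.+4, 0)%N) +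
    t * q ^+ h * (phi (h.*2.+1, 1)%N + phi (h.*2.+2, 0)%N).
  have e : (h.*2.+2 + 0 = h.+1.*2)%N by rewrite addn0 doubleS.
  rewrite /push !(lwT _ e) !(lwF _ e) /step /bmul /=.
  rewrite !(subn0, addn0, add0n, subn1, addn1, add1n, subSS, sub0n) /=.
  ring.
have -> : diag phi h.+2 = phi (0, h.*2.+4)%N + phi (1, h.*2.+3)%N +
    (\sum_(a < h.*2.+1) phi (a.+2, h.*2.+2 - a)%N + phi (h.*2.+3, 1)%N + phi (h.*2.+4, 0)%N).
  by rewrite diag_recll doubleS 2!big_ord_recr /= subnn subSnn.
rewrite mulrDl {1}(diag_recrr phi h) (diag_recll phi h) /diag; ring.
Qed.

Lemma sum_walk (n : nat) :
  \sum_(w <- words n | mst w == (0, 0)%N) x ^+ fpm w * t ^+ excm w * q ^+ crsm w =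
  motzkin x t q n 0.
Proof.
(* With a general test function the induction can follow the whole distribution: every state with
   [a + b = 2h] is reached with weight [motzkin x t q n h]. The indicator of [(0, 0)] gives the
   claim. *)
suff S phi : \sum_(w <- words n) wt w * phi (mst w) =
    \sum_(h < n.+1) motzkin x t q n h * diag phi h.
  have := S (fun u => (u == (0, 0)%N)%:R); rewrite big_ord_recl [X in _ = _ + X]big1 => [|h _].
    rewrite addr0 /diag big_ord1 /= mulr1 => <-.
    by rewrite big_mkcond; apply: eq_bigr => w _; case: ifP; rewrite ?mulr1 ?mulr0.
  rewrite /diag big1 ?mulr0 // => a _; case: eqP => // -[e1].
  by rewrite e1 subn0.
elim: n phi => [|n IH] phi.
  by rewrite big_seq1 big_ord1 /wt /= !expr0 !mul1r /diag big_ord1.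
rewrite big_words.
transitivity (\sum_(w <- words n) wt w * push phi (mst w)).
  by apply: eq_bigr => w _; rewrite !wt_cons !mst_cons /push /step; ring.
rewrite IH; under eq_bigr do rewrite diag_push mulrDr.
rewrite big_split /=.
have -> : \sum_(h < n.+2) motzkin x t q n.+1 h * diag phi h =
    \sum_(h < n.+1) motzkin x t q n h * (q ^+ h * diag phi h.+1) +
    \sum_(h < n.+2) motzkin x t q n h *
      ((if val h is h'.+1 then t * q ^+ h' + q ^+ h else x) * diag phi h) +
    \sum_(h < n.+2) motzkin x t q n h.+1 * (t * q ^+ h * diag phi h).
  rewrite big_ord_recl [X in _ + X + _]big_ord_recl [X in _ + _ + X]big_ord_recl /=.
  have -> : \sum_(i < n.+1) motzkin x t q n.+1 (bump 0 i) * diag phi (bump 0 i) =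
     \sum_(i < n.+1) (motzkin x t q n i * (q ^+ i * diag phi i.+1) +
      (motzkin x t q n i.+1 * ((t * q ^+ i + q ^+ i.+1) * diag phi i.+1) +
       motzkin x t q n i.+2 * (t * q ^+ i.+1 * diag phi i.+1))).
    by apply: eq_bigr => i _; rewrite /bump /= add1n; ring.
  by rewrite !big_split /= /bump /=; under [X in _ = _ + (_ + X) + _]eq_bigr do rewrite add1n; ring.
rewrite -addrA; congr (_ + _).
(* The top terms vanish, their heights exceeding the number of steps. *)
rewrite [X in _ = X + _]big_ord_recr /= motzkin_eq0 // mul0r addr0.
rewrite [X in _ = _ + X]big_ord_recr [X in _ = _ + (X + _)]big_ord_recr /=.
rewrite !(motzkin_eq0 _ _ _ (_ : n < _)%N) // !mul0r !addr0.
rewrite big_ord_recl [X in _ = X + _]big_ord_recl /= -addrA; congr (_ + _).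
by rewrite -big_split; apply: eq_bigr => i _; rewrite /bump /= add1n; ring.
Qed.

End WalkSum.

(** * Binary trees and Dyck paths *)

Inductive tree : Type := Leaf | Node of tree & tree.

Fixpoint tsz (t : tree) : nat :=
  if t is Node l r then (tsz l + tsz r).+1 else 0.

Fixpoint dyck (t : tree) : seq bool :=
  if t is Node l r then true :: dyck l ++ false :: dyck r else [::].

Lemma size_dyck (t : tree) : size (dyck t) = (tsz t).*2.
Proof. by elim: t => //= l IHl r IHr; rewrite size_cat /= IHl IHr; lia. Qed.

Lemma bst_dyck (t : tree) : bst (dyck t) = (0, 0).
Proof.
by elim: t => //= l IHl r IHr; rewrite bst_cat /= IHl IHr.
Qed.

(** A suffix that is empty or starts with a down step marks where the tree ends, which makes the
    parse unique. *)
Lemma dyck_cat_inj (t t' : tree) (w w' : seq bool) :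
  head false w = false -> head false w' = false ->
  dyck t ++ w = dyck t' ++ w' -> t = t' /\ w = w'.
Proof.
elim: t t' w w' => [|l IHl r IHr] [|l' r'] w w' //=.
- by move=> w0 w0' e; move: w0; rewrite e.
- by move=> w0 w0' e; move: w0'; rewrite -e.
move=> w0 w0' [+]; rewrite -!catA /= => /IHl[]// -> [+].
by move=> /IHr[]// -> ->.
Qed.

Lemma dyck_inj : injective dyck.
Proof.
move=> t t' e; have [] // := @dyck_cat_inj t t' [::] [::].
by rewrite !cats0.
Qed.

Lemma dyck_parse (w : seq bool) : bst w = (0, 0) -> exists t, dyck t = w.
Proof.
(* A path without unmatched up steps is a chain of Dyck paths separated by its unmatched down steps.
   A prepended up step consumes the first of these. *)
suff : forall w, (bst w).2 = 0 -> exists t ts, size ts = (bst w).1 /\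
    w = dyck t ++ flatten [seq false :: dyck u | u <- ts].
  move=> /(_ w) + w0; rewrite w0 => /(_ erefl)[t [[|u ts] [//= _ ->]]].
  by exists t; rewrite cats0.
elim=> [|c {}w IH] /=; first by exists Leaf, [::].
case: (bst w) IH => a b /= IH.
case: c => /= e.
  have {IH} [|t [ts [sts ->]]] := IH; first by lia.
  case: ts sts => [|t' ts] /= sts; first by lia.
  by exists (Node t t'), ts; rewrite /= -catA /=; split=> //; lia.
have {IH} [|t [ts [sts ->]]] := IH; first by lia.
by exists Leaf, (t :: ts); rewrite /= sts; split=> //; lia.
Qed.

Definition subw (w : seq bool) (i j : nat) : seq bool := drop i (take j w).

Lemma subw_cat (w1 w2 : seq bool) (i j : nat) : subw (w1 ++ w2) i j =
  subw w1 i j ++ subw w2 (i - size w1) (j - size w1).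
Proof.
rewrite /subw take_cat; case: ltnP => jn.
  have -> : j - size w1 = 0 by lia.
  by rewrite take0 /= cats0.
rewrite (take_oversize jn) drop_cat; case: ltnP => // ni.
  have -> : i - size w1 = 0 by lia.
  by rewrite drop0.
by rewrite (drop_oversize ni).
Qed.

(* A node of the tree drawn at abscissa s is given by the first and the last
   point of the path strictly inside the corresponding pair of matched steps. *)
Fixpoint nodes (t : tree) (s : nat) : seq (nat * nat) :=
  if t is Node l r then
    (s.+1, (s + (tsz l).*2).+1) ::
      nodes l s.+1 ++ nodes r (s + (tsz l).*2).+2
  else [::].

Definition inside (z : nat) (v : nat * nat) : bool := v.1 <= z <= v.2.

Definition sep (t : tree) (s x y : nat) : nat :=
  \sum_(v <- nodes t s) (inside x v && ~~ inside y v).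

Lemma nodes_bounds (t : tree) (s : nat) (v : nat * nat) : v \in nodes t s ->
  [/\ s < v.1, v.1 <= v.2 & v.2 < s + (tsz t).*2].
Proof.
elim: t s => //= l IHl r IHr s; rewrite inE mem_cat => /or3P[/eqP->|/IHl|/IHr] /=.
- by split; lia.
- by case=> *; split; lia.
by case=> *; split; lia.
Qed.

Lemma size_nodes (t : tree) (s : nat) : size (nodes t s) = tsz t.
Proof. by elim: t s => //= l IHl r IHr s; rewrite size_cat IHl IHr. Qed.

Lemma sep_eq0 (t : tree) (s x y : nat) :
  ~~ (s < x < s + (tsz t).*2) -> sep t s x y = 0.
Proof.
move=> h; rewrite /sep big1_seq // => v /andP[_ /nodes_bounds[]].
by rewrite /inside; lia.
Qed.

(** A down step between [x] and [y] is unmatched there when its partner precedes [x], that is, when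
    the pair encloses [x] but not [y]; dually for up steps. Truncated subtraction covers windows
    that start before the path. *)
Lemma bst_subw (t : tree) (s x y : nat) : x <= y ->
  bst (subw (dyck t) (x - s) (y - s)) = (sep t s x y, sep t s y x).
Proof.
move=> xy; elim: t s => [|l IHl r IHr] s; first by rewrite /sep !big_nil.
have sepE z z' : sep (Node l r) s z z' =
    (inside z (s.+1, (s + (tsz l).*2).+1) &&
     ~~ inside z' (s.+1, (s + (tsz l).*2).+1)) +
    sep l s.+1 z z' + sep r (s + (tsz l).*2).+2 z z'.
  by rewrite /sep /= big_cons big_cat /= addnA.
rewrite !sepE [dyck _]/= -cat1s -[false :: _]cat1s !subw_cat !bst_cat /= size_dyck.
have -> : x - s - 1 = x - s.+1 by lia.
have -> : y - s - 1 = y - s.+1 by lia.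
have -> : x - s.+1 - (tsz l).*2 - 1 = x - (s + (tsz l).*2).+2 by lia.
have -> : y - s.+1 - (tsz l).*2 - 1 = y - (s + (tsz l).*2).+2 by lia.
rewrite IHl IHr.
have sub1 c i j : i <= j -> bst (subw [:: c] i j) =
    if (i == 0) && (0 < j) then bgen c else (0, 0).
  by case: i j => [|i] [|j] //= ij; rewrite /subw /= ?bmul1.
rewrite !sub1; [|lia..].
have out_l z z' : (z <= s) || ((s + (tsz l).*2).+1 < z) -> sep l s.+1 z z' = 0.
  by move=> h; apply: sep_eq0; lia.
have out_r z z' : z <= (s + (tsz l).*2).+1 -> sep r (s + (tsz l).*2).+2 z z' = 0.
  by move=> h; apply: sep_eq0; lia.
move: out_l out_r; rewrite /inside /bmul /bgen /=.
move: (tsz l).*2 (sep l s.+1) (sep r _) => K A C Al Cr {IHl IHr sepE sub1}.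
have [xs|sx] := leqP x s; last have [xK|Kx] := leqP x (s + K).+1.
- rewrite (Al x) ?xs // (Cr x); last lia.
  have [ys|sy] := leqP y s; last have [yK|Ky] := leqP y (s + K).+1.
  + rewrite (Al y) ?ys // (Cr y); last lia.
    by do 2 case: ifP => ?; rewrite /=; congr pair; lia.
  + rewrite (Cr y) //; move: (A y x) => B {Al Cr A C}.
    by do 2 case: ifP => ?; rewrite /=; congr pair; lia.
  rewrite (Al y) ?Ky ?orbT //; move: (C y x) => B {Al Cr A C}.
  by do 2 case: ifP => ?; rewrite /=; congr pair; lia.
- rewrite (Cr x) //; move: (A x y) => A1.
  have [yK|Ky] := leqP y (s + K).+1.
    rewrite (Cr y) //; move: (A y x) => B {Al Cr A C}.
    by do 2 case: ifP => ?; rewrite /=; congr pair; lia.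
  rewrite (Al y) ?Ky ?orbT //; move: (C y x) => B {Al Cr A C}.
  by do 2 case: ifP => ?; rewrite /=; congr pair; lia.
have Ky : (s + K).+1 < y by lia.
rewrite (Al y) ?Ky ?orbT // (Al x) ?Kx ?orbT //.
move: (C y x) (C x y) => B B' {Al Cr A C}.
by do 2 case: ifP => ?; rewrite /=; congr pair; lia.
Qed.

Lemma sum_interval (N a b : nat) :
  \sum_(p < N) (a <= p < b) = minn b N - minn a N.
Proof.
elim: N => [|N IH]; first by rewrite big_ord0; lia.
by rewrite big_ord_recr /= IH; lia.
Qed.

Lemma sum_ord_eq (N c : nat) (b : bool) : \sum_(p < N) ((p == c :> nat) && b) = (c < N) && b.
Proof.
elim: N => [|N IH]; first by rewrite big_ord0.
by rewrite big_ord_recr /= IH; lia.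
Qed.

Lemma sum_iota_gt (a v k : nat) : \sum_(y <- iota v k) (a < y) = minn k (v + k - a.+1).
Proof.
elim: k => [|k IH]; first by rewrite big_nil; lia.
by rewrite -addn1 iotaD big_cat big_seq1 /= IH; lia.
Qed.

Lemma sum_iota_ge (a v k : nat) : \sum_(y <- iota v k) (a <= y) = minn k (v + k - a).
Proof.
elim: k => [|k IH]; first by rewrite big_nil; lia.
by rewrite -addn1 iotaD big_cat big_seq1 /= IH; lia.
Qed.

(* The arcs (position, value) of the 132-avoiding permutation of a tree, drawn
   with positions starting at u and values starting at v: the maximum separates
   a left block of larger values from a right block of smaller values. *)
Fixpoint tarcs (t : tree) (u v : nat) : seq (nat * nat) :=
  if t is Node l r then
    tarcs l u (v + tsz r) ++
      (u + tsz l, v + tsz l + tsz r) :: tarcs r (u + tsz l).+1 v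
  else [::].

Lemma tarcs1 (t : tree) (u v : nat) : unzip1 (tarcs t u v) = iota u (tsz t).
Proof.
elim: t u v => // l IHl r IHr u v; rewrite [tsz _]/= -addnS iotaD -(IHl u (v + tsz r)) /=.
by rewrite -(IHr _ v) /unzip1 map_cat.
Qed.

Lemma tarcs2 (t : tree) (u v : nat) : perm_eq (unzip2 (tarcs t u v)) (iota v (tsz t)).
Proof.
elim: t u v => // l IHl r IHr u v; rewrite [tsz _]/= /unzip2 map_cat [map _ (_ :: _)]/=.
have -> : iota v (tsz l + tsz r).+1 =
    iota v (tsz r) ++ iota (v + tsz r) (tsz l) ++ [:: v + tsz l + tsz r].
  by rewrite -addn1 (addnC (tsz l)) !iotaD -catA /=; congr (_ ++ (_ ++ [:: _])); lia.
rewrite -cat1s perm_sym perm_catC -catA perm_cat //; first by rewrite perm_sym IHl.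
by rewrite perm_cat // perm_sym IHr.
Qed.

Lemma size_tarcs (t : tree) (u v : nat) : size (tarcs t u v) = tsz t.
Proof. by rewrite -(size_map fst) [map _ _]tarcs1 size_iota. Qed.

Lemma tarcs_bounds (t : tree) (u v : nat) (a : nat * nat) : a \in tarcs t u v ->
  (u <= a.1 < u + tsz t) /\ (v <= a.2 < v + tsz t).
Proof.
move=> at_; split.
  by rewrite -mem_iota -(tarcs1 t u v) map_f.
by rewrite -mem_iota -(perm_mem (tarcs2 t u v)) map_f.
Qed.

Lemma tarcs_inj (t t' : tree) (u v : nat) :
  tsz t = tsz t' -> tarcs t u v = tarcs t' u v -> t = t'.
Proof.
elim: t t' u v => [|l IHl r IHr] [|l' r'] u v // [esz] e.
(* The place of the maximal value recovers the size of the left subtree. *)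
have findE (k j : tree) : find (fun a : nat * nat => a.2 == v + (tsz k + tsz j))
    (tarcs (Node k j) u v) = tsz k.
  rewrite /= find_cat; case: ifP => [/hasP[a /tarcs_bounds[_]]|_]; first by lia.
  by rewrite /= addnA eqxx addn0 size_tarcs.
have el : tsz l = tsz l' by rewrite -(findE l r) esz e findE.
have er : tsz r = tsz r' by lia.
move: e => /= /eqP; rewrite -el -er eqseq_cat ?size_tarcs // eqseq_cons.
by case/and3P=> /eqP/(IHl _ _ _ el)-> _ /eqP/(IHr _ _ _ er)->.
Qed.

Definition cross (a b : nat * nat) : bool :=
  [&& a.1 < b.1, b.1 < a.2 & a.2 < b.2] || [&& a.2 < b.2, b.2 <= a.1 & a.1 < b.1].

Definition crsA (A : seq (nat * nat)) : nat := \sum_(a <- A) \sum_(b <- A) cross a b.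

(** Two arcs forming an inversion never cross, which leaves only left arcs against the maximum. The
    two minima count the left values beyond the position of the maximum and the left positions at or
    beyond its value. *)
Lemma crsA_tarcs (l r : tree) (u v : nat) :
  crsA (tarcs (Node l r) u v) =
    crsA (tarcs l u (v + tsz r)) + crsA (tarcs r (u + tsz l).+1 v) +
    (minn (tsz l) (v + tsz r - u.+1) + minn (tsz l) (u - (v + tsz r))).
Proof.
rewrite /crsA /= big_cat big_cons /=.
under eq_bigr do rewrite big_cat big_cons.
under [\sum_(a <- tarcs r _ _) _]eq_bigr do rewrite big_cat big_cons.
rewrite big_cat big_cons /= !big_split /=.
set M := (u + tsz l, v + tsz l + tsz r).
have lr a b : a \in tarcs l u (v + tsz r) -> b \in tarcs r (u + tsz l).+1 v ->
    cross a b = false /\ cross b a = false.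
  by move=> /tarcs_bounds[? ?] /tarcs_bounds[? ?]; rewrite /cross; lia.
have Mr b : b \in tarcs r (u + tsz l).+1 v -> cross M b = false /\ cross b M = false.
  by move=> /tarcs_bounds[? ?]; rewrite /cross /M /=; lia.
have Ml a : a \in tarcs l u (v + tsz r) -> cross M a = false.
  by move=> /tarcs_bounds[? ?]; rewrite /cross /M /=; lia.
have -> : cross M M = false by rewrite /cross /M /=; lia.
rewrite [\sum_(a <- tarcs l _ _) \sum_(b <- tarcs r _ _) _]big1_seq; last first.
  move=> a /andP[_ ha]; rewrite big1_seq // => b /andP[_ hb].
  by rewrite (lr a b ha hb).1.
rewrite [\sum_(a <- tarcs r _ _) \sum_(b <- tarcs l _ _) _]big1_seq; last first.
  move=> b /andP[_ hb]; rewrite big1_seq // => a /andP[_ ha].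
  by rewrite (lr a b ha hb).2.
rewrite [\sum_(b <- tarcs r _ _) cross M b]big1_seq; last by move=> b /andP[_ /Mr[-> _]].
rewrite [\sum_(b <- tarcs r _ _) cross b M]big1_seq; last by move=> b /andP[_ /Mr[_ ->]].
rewrite [\sum_(b <- tarcs l _ _) cross M b]big1_seq; last by move=> b /andP[_ /Ml ->].
have -> : \sum_(a <- tarcs l u (v + tsz r)) cross a M =
    \sum_(a <- tarcs l u (v + tsz r)) (u + tsz l < a.2) +
    \sum_(a <- tarcs l u (v + tsz r)) (v + tsz l + tsz r <= a.1).
  rewrite -big_split; apply: eq_big_seq => a /tarcs_bounds[].
  by rewrite /cross /M /=; lia.
rewrite -(big_map snd xpredT (fun y => nat_of_bool (u + tsz l < y))).
rewrite (perm_big _ (tarcs2 l u (v + tsz r))) /= sum_iota_gt.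
rewrite -(big_map fst xpredT (fun y => nat_of_bool (v + tsz l + tsz r <= y))).
rewrite [map _ _]tarcs1 sum_iota_ge; lia.
Qed.

Definition excA (A : seq (nat * nat)) : nat := \sum_(a <- A) (a.1 < a.2).

Definition fpA (A : seq (nat * nat)) : nat := \sum_(a <- A) (a.1 == a.2).

(** * Matched steps seen from the middle line *)

Section Middle.

Variable N : nat.

(** The hypothesis is the induction invariant saying that value minus position of an arc equals [N]
    minus the centre of its node. *)
Lemma excA_nodes (t : tree) (u v s : nat) : N + u = s + tsz t + v ->
  excA (tarcs t u v) = \sum_(x <- nodes t s) (x.1 + x.2 < N.*2).
Proof.
elim: t u v s => [|l IHl r IHr] u v s e; first by rewrite /excA !big_nil.
rewrite /= in e; rewrite /excA /= big_cat !big_cons big_cat /=.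
rewrite -!/(excA _) (IHl _ _ s.+1) ?(IHr _ _ (s + (tsz l).*2).+2); lia.
Qed.

Lemma fpA_nodes (t : tree) (u v s : nat) : N + u = s + tsz t + v ->
  fpA (tarcs t u v) = \sum_(x <- nodes t s) (x.1 + x.2 == N.*2).
Proof.
elim: t u v s => [|l IHl r IHr] u v s e; first by rewrite /fpA !big_nil.
rewrite /= in e; rewrite /fpA /= big_cat !big_cons big_cat /=.
rewrite -!/(fpA _) (IHl _ _ s.+1) ?(IHr _ _ (s + (tsz l).*2).+2); lia.
Qed.

(** The number of windows symmetric about the middle that contain exactly one of the two matched
    steps. *)
Definition half_visible (x : nat * nat) : nat :=
  \sum_(p < N) (inside (N - p.+1) x (+) inside (N + p.+1) x).

(** The size of a symmetric difference plus twice that of the intersection is the sum of the two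
    sizes, applied to two intervals of radii [p]; if they meet, both start at 0. *)
Lemma half_visibleE (lo hi : nat) : 0 < lo -> lo <= hi -> hi < N.*2 ->
  half_visible (lo, hi) + (minn (N - lo) (hi - N)).*2 =
  (minn hi.+1 N - minn lo N) + ((hi - N) - (lo.-1 - N)).
Proof.
move=> lo0 lohi hiN.
have -> : minn hi.+1 N - minn lo N = \sum_(p < N) (N - hi.+1 <= p < N - lo).
  by rewrite sum_interval; lia.
have -> : hi - N - (lo.-1 - N) = \sum_(p < N) (lo.-1 - N <= p < hi - N).
  by rewrite sum_interval; lia.
have -> : minn (N - lo) (hi - N) = \sum_(p < N) (0 <= p < minn (N - lo) (hi - N)).
  by rewrite sum_interval; lia.
rewrite /half_visible -mul2n big_distrr -!big_split /=.
apply: eq_bigr => p _; have pN := ltn_ord p.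
have -> : inside (N - p.+1) (lo, hi) = (N - hi.+1 <= p < N - lo).
  by rewrite /inside /=; apply/andP/andP => -[]; lia.
have -> : inside (N + p.+1) (lo, hi) = (lo.-1 - N <= p < hi - N).
  by rewrite /inside /=; apply/andP/andP => -[]; lia.
have -> : (p < minn (N - lo) (hi - N)) =
    (N - hi.+1 <= p < N - lo) && (lo.-1 - N <= p < hi - N).
  by rewrite leq_min; case: ltnP => h1; case: ltnP => h2; rewrite ?andbF //= !andbT; lia.
by case: (_ <= p < _); case: (_ <= p < _).
Qed.

(** The right side doubles the crossings gained in [crsA_tarcs] and the excedance of the maximum.
    The three cases are a pair left of the middle line, right of it, or astride. *)
Lemma half_visible_node (k r u v s : nat) :
  N + u = s + (k + r).+1 + v -> s + (k + r).+1.*2 <= N.*2 ->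
  half_visible (s.+1, (s + k.*2).+1) + ((s + k.*2).+1 < N) =
  (minn k (v + r - u.+1) + minn k (u - (v + r)) + (u + k < v + k + r)).*2 + (N < s.+1).
Proof.
move=> e le.
have := @half_visibleE s.+1 (s + k.*2).+1 ltac:(lia) ltac:(lia) ltac:(lia).
move: (half_visible _) => h.
have [h1|h1] := ltnP (s + k.*2).+1 N.
  rewrite (minn_idPl (_ : (s + k.*2).+2 <= N)) // (minn_idPl (_ : s.+1 <= N)); last lia.
  have -> : (s + k.*2).+1 - N = 0 by lia.
  rewrite minn0 (minn_idPl (_ : k <= v + r - u.+1)); last lia.
  have -> : u - (v + r) = 0 by lia.
  by rewrite minn0; lia.
have [h2|h2] := ltnP N s.+1.
  rewrite (minn_idPr (_ : N <= (s + k.*2).+2)); last lia.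
  have -> : N - s.+1 = 0 by lia.
  have -> : v + r - u.+1 = 0 by lia.
  rewrite min0n minn0 (minn_idPl (_ : k <= u - (v + r))); last lia.
  by lia.
rewrite (minn_idPr (_ : N <= (s + k.*2).+2)); last lia.
rewrite (minn_idPr (_ : v + r - u.+1 <= k)); last lia.
rewrite (minn_idPr (_ : u - (v + r) <= k)); last lia.
by have [h3|h3] := leqP (N - s.+1) ((s + k.*2).+1 - N); lia.
Qed.

(* A pair of matched steps left (right) of the middle line is counted half a
   unit too little (too much). *)
Lemma crsA_nodes (t : tree) (u v s : nat) :
  N + u = s + tsz t + v -> s + (tsz t).*2 <= N.*2 ->
  (crsA (tarcs t u v) + excA (tarcs t u v)).*2 + \sum_(x <- nodes t s) (N < x.1) =
  \sum_(x <- nodes t s) half_visible x + \sum_(x <- nodes t s) (x.2 < N).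
Proof.
elim: t u v s => [|l IHl r IHr] u v s e le.
  by rewrite /crsA /excA !big_nil.
rewrite crsA_tarcs /=; rewrite /= in e le.
have {}IHl := IHl u (v + tsz r) s.+1 ltac:(lia) ltac:(lia).
have {}IHr := IHr (u + tsz l).+1 v (s + (tsz l).*2).+2 ltac:(lia) ltac:(lia).
have -> : excA (tarcs (Node l r) u v) = excA (tarcs l u (v + tsz r)) +
    ((u + tsz l < v + tsz l + tsz r) + excA (tarcs r (u + tsz l).+1 v)).
  by rewrite /excA /= big_cat big_cons.
rewrite !big_cons !big_cat /=.
have := half_visible_node e le; move: IHl IHr.
lia.
Qed.

(** Both sides count the steps of the path that lie left of the middle: up steps end at [x.1], down
    steps at [x.2 + 1]. *)
Lemma nodes_balance (t : tree) (s : nat) :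
  \sum_(x <- nodes t s) (x.1 <= N) + \sum_(x <- nodes t s) (x.2 < N) =
  minn N (s + (tsz t).*2) - minn N s.
Proof.
elim: t s => [|l IHl r IHr] s; first by rewrite !big_nil /=; lia.
have {}IHl := IHl s.+1; have {}IHr := IHr (s + (tsz l).*2).+2.
by rewrite /= !big_cons !big_cat /=; lia.
Qed.

Variables (t : tree) (w : seq letter).
Hypotheses (tN : tsz t = N) (wN : size w = N) (wt : unfold_path w = dyck t).

(** The whole path has [N] up steps and also [N] steps left of the middle, so equally many pairs lie
    strictly left and strictly right, and the corrections cancel. *)
Lemma crsA_half_visible :
  (crsA (tarcs t 0 0) + excA (tarcs t 0 0)).*2 = \sum_(x <- nodes t 0) half_visible x.
Proof.
have := @crsA_nodes t 0 0 0 ltac:(lia) ltac:(lia); have := nodes_balance t 0.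
have : \sum_(x <- nodes t 0) (x.1 <= N) + \sum_(x <- nodes t 0) (N < x.1) = N.
  transitivity (size (nodes t 0)); last by rewrite size_nodes.
  by rewrite -big_split -sum1_size; apply: eq_bigr => x _ /=; lia.
lia.
Qed.

Let subw_mid (l m r : seq bool) : subw (l ++ m ++ r) (size l) (size l + size m) = m.
Proof. by rewrite /subw catA take_size_cat ?size_cat // drop_size_cat. Qed.

Let unfold_path_cat (w1 w2 : seq letter) : exists l r,
  [/\ unfold_path (w1 ++ w2) = l ++ unfold_path w2 ++ r,
      size l = size w1 & size r = size w1].
Proof.
elim: w1 => [|c w1 [l [r [e sl sr]]]]; first by exists [::], [::]; rewrite /= cats0.
exists (c.1 :: l), (rcons r c.2); rewrite /= e sl size_rcons sr; split => //.
by rewrite -!rcons_cat.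
Qed.

Let size_unfold_path (w' : seq letter) : size (unfold_path w') = (size w').*2.
Proof. by elim: w' => //= c w' IH; rewrite size_rcons IH. Qed.

Let mst_sep (w1 w2 : seq letter) (p := size w2) : w = w1 ++ w2 ->
  mst w2 = (sep t 0 (N - p) (N + p), sep t 0 (N + p) (N - p)).
Proof.
move=> e; have [l [r [el sl sr]]] := unfold_path_cat w1 w2.
have eN : N = size w1 + p by rewrite -wN e size_cat.
rewrite -bst_subw; last by lia.
rewrite !subn0 -wt e el /mst; congr bst.
rewrite -{1}(subw_mid l (unfold_path w2) r) sl size_unfold_path -/p; congr subw; lia.
Qed.

Section Step.

Variables (w1 w2 : seq letter) (c : letter).
Hypothesis ew : w = w1 ++ c :: w2.

Let p := size w2.
Let x := N - p.
Let y := N + p.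

Let eN : N = (size w1 + p).+1.
Proof. by rewrite -wN ew size_cat /= addnS. Qed.

(** The windows of the inner path, of the added first step, and of the inner path extended on the
    left, on the right and on both sides. *)
Let seps :
  [/\ mst w2 = (sep t 0 x y, sep t 0 y x),
      bgen c.1 = (sep t 0 x.-1 x, sep t 0 x x.-1),
      bmul (bgen c.1) (mst w2) = (sep t 0 x.-1 y, sep t 0 y x.-1),
      bmul (mst w2) (bgen c.2) = (sep t 0 x y.+1, sep t 0 y.+1 x) &
      mst (c :: w2) = (sep t 0 x.-1 y.+1, sep t 0 y.+1 x.-1)].
Proof.
have [l [r [el sl sr]]] := unfold_path_cat w1 (c :: w2).
set m := unfold_path w2; have sm : size m = p.*2 by rewrite size_unfold_path.
have eD : dyck t = l ++ [:: c.1] ++ m ++ [:: c.2] ++ r.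
  by rewrite -wt ew el /= -cats1 -!catA.
have mid l' m' r' a b : dyck t = l' ++ m' ++ r' -> a = size l' -> b = a + size m' ->
    bst m' = (sep t 0 a b, sep t 0 b a).
  move=> e ea eb; rewrite -bst_subw; last by lia.
  by rewrite !subn0 e eb ea subw_mid.
have sx : x = (size w1).+1 by rewrite /x; lia.
have sy : y = x + p.*2 by rewrite /y; lia.
split.
- apply: (mid (l ++ [:: c.1]) m ([:: c.2] ++ r)); rewrite ?size_cat /=; try lia.
  by rewrite eD -!catA.
- rewrite -[bgen c.1]bmul1; apply: (mid l [:: c.1] (m ++ [:: c.2] ++ r)) => //=; lia.
- apply: (mid l (c.1 :: m) ([:: c.2] ++ r)); rewrite /= ?sm ?sl; try lia.
  by rewrite eD.
- rewrite -[bgen c.2]bmul1 -(bst_cat m [:: c.2]).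
  apply: (mid (l ++ [:: c.1]) (m ++ [:: c.2]) r); rewrite ?size_cat /= ?sm ?sl; try lia.
  by rewrite eD -!catA.
apply: (mid l (unfold_path (c :: w2)) r); rewrite /= ?size_rcons -/m ?sm ?sl; try lia.
by rewrite eD -cats1 /= -!catA.
Qed.

(** Detects whether the added first step is an up step whose partner ends by abscissa [z]. *)
Let lo_lt (z : nat) : nat := \sum_(v <- nodes t 0) ((v.1 == x) && (v.2 < z)).

(** When the added step goes up, no pair closes at it, so a pair enclosing [x] either encloses
    [x.-1] too or opens at this step. *)
Let sep_lo (z : nat) : x <= z -> c.1 -> sep t 0 x z = sep t 0 x.-1 z + lo_lt z.
Proof.
move=> xz c1; have [_ e _ _ _] := seps; move: e; rewrite c1 => -[e _].
have : sep t 0 x z + \sum_(v <- nodes t 0) [&& inside x.-1 v, ~~ inside x v & ~~ inside z v] =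
    sep t 0 x.-1 z + lo_lt z.
  rewrite -!big_split; apply: eq_big_seq => v /nodes_bounds[].
  by rewrite /inside /=; move: eN; rewrite /x /p; lia.
rewrite [X in _ + X]big1_seq ?addn0 // => v /andP[_ hv].
have /eqP := esym e; rewrite sum_nat_seq_eq0 => /allP/(_ v hv) /=; lia.
Qed.

Let lo_lt0 (z : nat) : ~~ c.1 -> lo_lt z = 0.
Proof.
move=> /negbTE c1; have [_ e _ _ _] := seps; move: e; rewrite c1 => -[_ e].
apply: big1_seq => v /andP[_ hv].
have /eqP := esym e; rewrite sum_nat_seq_eq0 => /allP/(_ v hv) /=.
have [] := nodes_bounds hv; rewrite /inside; move: eN; rewrite /x /p; lia.
Qed.

Lemma excm_step : \sum_(v <- nodes t 0) ((v.1 == x) && (v.2 < y)) = (c.1 && (0 < (mst w2).1)).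
Proof.
rewrite -/(lo_lt y); case: (boolP c.1) => [c1|/lo_lt0->//] /=.
have := sep_lo _ c1 (z := y) ; have [-> _ e _ _] := seps.
move: e; have [-> _ _ _ _] := seps; rewrite c1 /bmul /= => -[<- _].
have : x <= y by rewrite /x /y; lia.
lia.
Qed.

Lemma fpm_step : \sum_(v <- nodes t 0) ((v.1 == x) && (v.2 == y)) =
  [&& c.1, ~~ c.2 & mst w2 == (0, 0)].
Proof.
have : lo_lt y.+1 = lo_lt y + \sum_(v <- nodes t 0) ((v.1 == x) && (v.2 == y)).
  by rewrite -big_split; apply: eq_bigr => v _ /=; lia.
case: (boolP c.1) => [c1|/lo_lt0 lo0] /=; last by rewrite !lo0.
have xy : x <= y by rewrite /x /y; lia.
have := sep_lo xy c1; have := sep_lo (leqW xy) c1.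
have [e1 _ e3 e4 e5] := seps.
move: e3 e4 e5; rewrite mst_cons e1 c1.
move: (sep t 0 x y) (sep t 0 y x) => a b.
rewrite /bmul /= => -[e6 e7] [e8 e9] [e10 e11].
rewrite xpair_eqE; case: (c.2) e8 e9 e10 e11 => /=; lia.
Qed.

End Step.

Lemma excm_nodes : excm w = excA (tarcs t 0 0).
Proof.
have S w1 w2 : w = w1 ++ w2 -> excm w2 =
    \sum_(p < size w2) \sum_(v <- nodes t 0) ((v.1 == N - p) && (v.2 < N + p)).
  elim: w2 w1 => [|c w2 IH] w1 e; first by rewrite big_ord0.
  rewrite [size _]/= big_ord_recr /= (excm_step e) addnC; congr (_ + _).
  by apply: (IH (rcons w1 c)); rewrite cat_rcons.
rewrite (S [::] w erefl) exchange_big (@excA_nodes t 0 0 0); last lia.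
apply: eq_big_seq => -[lo hi] /nodes_bounds[]; rewrite wN /= => h1 h2 h3.
(* A pair is recorded when its up step is read, at [p = N - lo]; then [hi < N + p] says that its
   centre is left of the middle. *)
transitivity (\sum_(p < N) ((p == N - lo :> nat) && (lo + hi < N.*2))).
  by apply: eq_bigr => p _; have := ltn_ord p; lia.
by rewrite sum_ord_eq; lia.
Qed.

Lemma fpm_nodes : fpm w = fpA (tarcs t 0 0).
Proof.
have S w1 w2 : w = w1 ++ w2 -> fpm w2 =
    \sum_(p < size w2) \sum_(v <- nodes t 0) ((v.1 == N - p) && (v.2 == N + p)).
  elim: w2 w1 => [|c w2 IH] w1 e; first by rewrite big_ord0.
  rewrite [size _]/= big_ord_recr /= (fpm_step e) addnC; congr (_ + _).
  by apply: (IH (rcons w1 c)); rewrite cat_rcons.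
rewrite (S [::] w erefl) exchange_big (@fpA_nodes t 0 0 0); last lia.
apply: eq_big_seq => -[lo hi] /nodes_bounds[]; rewrite wN /= => h1 h2 h3.
transitivity (\sum_(p < N) ((p == N - lo :> nat) && (lo + hi == N.*2))).
  by apply: eq_bigr => p _; have := ltn_ord p; lia.
by rewrite sum_ord_eq; lia.
Qed.

Lemma crsm_nodes : crsm w = crsA (tarcs t 0 0).
Proof.
pose g p := sep t 0 (N - p) (N + p) + sep t 0 (N + p) (N - p).
(* Adding the excedances undoes the subtraction in [crsm], and evenness of [g p] undoes the
   halving. *)
have S w1 w2 : w = w1 ++ w2 -> (crsm w2 + excm w2).*2 = \sum_(p < size w2) g p.
  elim: w2 w1 => [|c w2 IH] w1 e; first by rewrite big_ord0.
  have e' : w = rcons w1 c ++ w2 by rewrite cat_rcons.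
  rewrite [size _]/= big_ord_recr /= -(IH _ e') /g.
  have := mst_even w2; rewrite (mst_sep e') /=.
  case: (c.1) => /=; lia.
have gN : g N = 0 by rewrite /g !sep_eq0 // ?subnn ?addnn ?tN; lia.
have g0 : g 0 = 0.
  by rewrite /g subn0 addn0 /sep big1 // => v _; case: inside.
(* The word sees windows of radius 0 to [N - 1], while [half_visible] uses 1 to [N]; the two extreme
   windows contribute nothing. *)
have e : \sum_(p < N) g p = \sum_(p < N) g p.+1.
  have : \sum_(p < N.+1) g p = \sum_(p < N.+1) g p by [].
  by rewrite {1}big_ord_recr big_ord_recl /= gN g0 addn0 add0n.
have := crsA_half_visible; rewrite -excm_nodes.
have -> : \sum_(v <- nodes t 0) half_visible v = \sum_(p < N) g p.+1.
  rewrite exchange_big; apply: eq_bigr => p _.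
  rewrite /g /sep -big_split; apply: eq_bigr => v _ /=.
  by case: inside; case: inside.
by have := S [::] w erefl; rewrite wN -e; lia.
Qed.

End Middle.

(** * Permutations avoiding 132 *)

Definition av132 (A : seq (nat * nat)) : Prop :=
  forall a b c : nat * nat, a \in A -> b \in A -> c \in A ->
  a.1 < b.1 < c.1 -> a.2 < c.2 < b.2 -> False.

(** The place of the last entry of a 132 decides: in the left block all three entries are there, at
    the maximum nothing exceeds it, and in the right block the smaller first entry, and so all
    three, are there. *)
Lemma av132_tarcs (t : tree) (u v : nat) : av132 (tarcs t u v).
Proof.
elim: t u v => [|l IHl r IHr] u v a b c // aA bA cA pos val.
have in_l (x : nat * nat) : x \in tarcs (Node l r) u v -> x.1 < u + tsz l ->
    x \in tarcs l u (v + tsz r).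
  by rewrite /= mem_cat inE => /or3P[//|/eqP->|/tarcs_bounds[]] /=; lia.
have in_r (x : nat * nat) : x \in tarcs (Node l r) u v ->
    (u + tsz l < x.1) || (x.2 < v + tsz r) -> x \in tarcs r (u + tsz l).+1 v.
  by rewrite /= mem_cat inE => /or3P[/tarcs_bounds[]|/eqP->|//] /=; lia.
have [_ b2] := tarcs_bounds bA.
move: (cA); rewrite /= mem_cat inE => /or3P[cl|/eqP ec|cr].
- have [c1 _] := tarcs_bounds cl.
  by apply: (IHl _ _ _ _ _ _ _ cl pos val); apply: in_l => //; lia.
- by move: b2 val; rewrite ec /=; lia.
have [_ c2] := tarcs_bounds cr.
have ar : a \in tarcs r (u + tsz l).+1 v by apply: in_r => //; lia.
have [a1 _] := tarcs_bounds ar.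
by apply: (IHr _ _ _ _ _ ar _ cr pos val); apply: in_r => //; lia.
Qed.

(** Sorting both parts yields a sorted rearrangement of the interval, hence the interval itself. *)
Lemma perm_iota_split (w1 w2 : seq nat) (v m : nat) :
  perm_eq (w1 ++ w2) (iota v m) -> {in w1 & w2, forall x y, y <= x} ->
  perm_eq w2 (iota v (size w2)) /\ perm_eq w1 (iota (v + size w2) (size w1)).
Proof.
move=> pw le; have em : m = size w2 + size w1.
  by rewrite -(size_iota v m) -(perm_size pw) size_cat addnC.
have /eqP : sort leq w2 ++ sort leq w1 = iota v m.
  apply: (sorted_eq leq_trans anti_leq).
  - rewrite (sorted_pairwise leq_trans) pairwise_cat -!(sorted_pairwise leq_trans).
    rewrite !(sort_sorted leq_total) !andbT.
    by apply/allrelP => y x; rewrite !mem_sort => yw xw; apply: le.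
  - exact: iota_sorted.
  apply: perm_trans pw; rewrite perm_catC.
  by apply: perm_cat; rewrite perm_sort.
rewrite em iotaD eqseq_cat ?size_sort ?size_iota // => /andP[/eqP <- /eqP <-].
by rewrite !(perm_sym _ (sort _ _)) !perm_sort.
Qed.

Lemma tree_of_av132 (A : seq (nat * nat)) (u v : nat) :
  unzip1 A = iota u (size A) -> perm_eq (unzip2 A) (iota v (size A)) ->
  av132 A -> exists t, tarcs t u v = A.
Proof.
have [k] := ubnP (size A); elim: k A u v => // k IH A u v; rewrite ltnS => Ak p1 p2 av.
case: (posnP (size A)) => [/size0nil->|A0]; first by exists Leaf.
have : v + (size A).-1 \in unzip2 A by rewrite (perm_mem p2) mem_iota; lia.
case/mapP=> -[i M] /= iM eM; case/splitPr: iM Ak p1 p2 av A0 eM => A1 A2.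
rewrite size_cat /= => Ak p1 p2 av _ eM.
have {}eM : M = v + (size A1 + size A2) by rewrite -eM addnS.
have [e1 ei e2] : [/\ unzip1 A1 = iota u (size A1), i = u + size A1 &
    unzip1 A2 = iota (u + size A1).+1 (size A2)].
  move: p1; rewrite iotaD /unzip1 map_cat => /eqP.
  rewrite eqseq_cat ?size_map ?size_iota //= eqseq_cons.
  by case/and3P=> /eqP-> /eqP-> /eqP->.
have p2' : perm_eq (unzip2 A1 ++ unzip2 A2) (iota v (size A1 + size A2)).
  move: p2; rewrite /unzip2 map_cat /= addnS -addn1 iotaD -eM.
  by rewrite -[M :: map _ _]cat1s perm_catCA perm_sym perm_catC perm_cat2l perm_sym.
(* A smaller value before the maximum and a larger one after it would form a 132 with the
   maximum. *)
have lt : {in unzip2 A1 & unzip2 A2, forall x y, y <= x}.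
  move=> _ _ /mapP[a aA ->] /mapP[b bA ->]; rewrite leqNgt; apply/negP => ab.
  have a1 : a.1 < u + size A1.
    by have := map_f fst aA; rewrite [map _ _]e1 mem_iota; lia.
  have b1 : u + size A1 < b.1.
    by have := map_f fst bA; rewrite [map _ _]e2 mem_iota; lia.
  have b2 : b.2 < v + (size A1 + size A2).
    have : b.2 \in unzip2 A1 ++ unzip2 A2 by rewrite mem_cat (map_f snd bA) orbT.
    by rewrite (perm_mem p2') mem_iota; lia.
  apply: (av a (i, M) b); rewrite ?mem_cat ?inE ?aA ?bA ?eqxx ?orbT //= ?ei ?eM.
  - by rewrite a1 b1.
  by rewrite ab b2.
have [q2 q1] := perm_iota_split p2' lt.
rewrite !size_map in q1 q2.
have [||l el] := IH A1 u (v + size A2) _ e1 q1; first lia.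
  by move=> a b c aA bA cA; apply: av; rewrite mem_cat ?aA ?bA ?cA.
have [||r er] := IH A2 (u + size A1).+1 v _ e2 q2; first lia.
  by move=> a b c aA bA cA; apply: av; rewrite mem_cat inE ?aA ?bA ?cA !orbT.
have sl : tsz l = size A1 by rewrite -(size_tarcs l u (v + size A2)) el.
have sr : tsz r = size A2 by rewrite -(size_tarcs r (u + size A1).+1 v) er.
by exists (Node l r); rewrite /= sl sr el er ei eM addnA.
Qed.

Definition parcs (n : nat) (s : 'S_n) : seq (nat * nat) :=
  [seq (val i, val (s i)) | i <- enum 'I_n].

Lemma size_parcs (n : nat) (s : 'S_n) : size (parcs s) = n.
Proof. by rewrite size_map size_enum_ord. Qed.

Lemma parcs1 (n : nat) (s : 'S_n) : unzip1 (parcs s) = iota 0 n.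
Proof. by rewrite /unzip1 -map_comp -val_enum_ord; apply: eq_map. Qed.

Lemma parcs2 (n : nat) (s : 'S_n) : perm_eq (unzip2 (parcs s)) (iota 0 n).
Proof.
rewrite /unzip2 -map_comp; apply: uniq_perm; last first.
- move=> k; rewrite mem_iota /= add0n; apply/mapP/idP => [[i _ ->]|kn]; first exact: ltn_ord.
  by exists (s^-1%g (Ordinal kn)); rewrite ?mem_enum //= permKV.
- exact: iota_uniq.
rewrite map_inj_uniq ?enum_uniq // => i j /= /val_inj; exact: perm_inj.
Qed.

Lemma parcs_inj (n : nat) : injective (@parcs n).
Proof.
move=> s s' /eq_in_map e; apply/permP => i; apply: val_inj.
by have := e i; rewrite mem_enum => /(_ isT) [].
Qed.

Lemma big_parcs (n : nat) (s : 'S_n) (F : nat * nat -> nat) :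
  \sum_(a <- parcs s) F a = \sum_i F (val i, val (s i)).
Proof. by rewrite big_map big_enum. Qed.

Lemma av132_parcs (n : nat) (s : 'S_n) : av132 (parcs s) <-> ~~ contains p132 s.
Proof.
split=> [av|av _ _ _ /mapP[i _ ->] /mapP[j _ ->] /mapP[k _ ->] /= h1 h2].
  apply/contains132P => -[i [j [k [h1 h2]]]].
  by apply: (av (val i, val (s i)) (val j, val (s j)) (val k, val (s k))) => //;
    apply/mapP; [exists i|exists j|exists k]; rewrite ?mem_enum.
by apply/(negP av)/contains132P; exists i, j, k.
Qed.

Lemma perm_of_tree (t : tree) (n : nat) : tsz t = n ->
  exists s : 'S_n, parcs s = tarcs t 0 0.
Proof.
move=> <-; set w := unzip2 (tarcs t 0 0).
have pw : perm_eq w (iota 0 (tsz t)) := tarcs2 t 0 0.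
have sw : size w = tsz t by rewrite (perm_size pw) size_iota.
have lt (i : 'I_(tsz t)) : nth 0 w i < tsz t.
  have : nth 0 w i \in w by rewrite mem_nth ?sw.
  by rewrite (perm_mem pw) mem_iota.
have g_inj : injective (fun i => Ordinal (lt i)).
  move=> i j [/eqP]; rewrite nth_uniq ?sw ?ltn_ord ?(perm_uniq pw) ?iota_uniq //.
  by move/eqP/val_inj.
exists (perm g_inj); rewrite -(zip_unzip (parcs _)) -(zip_unzip (tarcs t 0 0)).
rewrite parcs1 tarcs1 -/w; congr zip.
rewrite /unzip2 -map_comp -[RHS](mkseq_nth 0) sw /mkseq -val_enum_ord -map_comp.
by apply: eq_map => i /=; rewrite permE.
Qed.

Lemma unfold_path_surj (b : seq bool) (n : nat) : size b = n.*2 ->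
  exists2 w, size w = n & unfold_path w = b.
Proof.
elim: n b => [|n IH] b; first by move/size0nil->; exists [::].
case: b => // c b; case/lastP: b => // b d; rewrite /= size_rcons => -[/IH[w sw ew]].
by exists ((c, d) :: w); rewrite /= ?sw ?ew.
Qed.

Lemma unfold_path_inj (w w' : seq letter) :
  size w = size w' -> unfold_path w = unfold_path w' -> w = w'.
Proof.
elim: w w' => [|[c d] w IH] [|[c' d'] w'] //= [sw] [-> /rcons_inj[e ->]].
by rewrite (IH w').
Qed.

Lemma sum_av132 (R : comNzRingType) (x t q : R) (n : nat) :
  (\sum_(s in avoiders p132 n) x ^+ st_fp s * t ^+ st_exc s * q ^+ st_crs s =
   motzkin x t q n 0)%R.
Proof.
rewrite -sum_walk -[RHS]big_filter -[LHS]big_enum /=.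
(* The tree is the link: its arcs give the permutation, its Dyck path the word. *)
pose E (s : 'S_n) w := exists T, [/\ tsz T = n, size w = n, parcs s = tarcs T 0 0 &
  unfold_path w = dyck T].
apply: (@big_rel _ _ _ _ _ E).
- exact: enum_uniq.
- by rewrite filter_uniq // words_uniq.
- move=> s; rewrite mem_enum inE => /av132_parcs av.
  have [||T eT] := @tree_of_av132 (parcs s) 0 0 _ _ av.
  + by rewrite parcs1 size_parcs.
  + by rewrite size_parcs parcs2.
  have sT : tsz T = n by rewrite -(size_tarcs T 0 0) eT size_parcs.
  have [|w sw ew] := @unfold_path_surj (dyck T) n; first by rewrite size_dyck sT.
  exists w; last by exists T.
  by rewrite mem_filter /mst ew bst_dyck mem_words sw !eqxx.
- move=> w; rewrite mem_filter mem_words => /andP[/eqP mw /eqP sw].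
  have [T eT] := dyck_parse mw.
  have sT : tsz T = n.
    have : size (dyck T) = n.*2.
      by rewrite eT -sw; elim: (w) => //= c w' IH; rewrite size_rcons IH.
    by rewrite size_dyck => /double_inj.
  have [s es] := perm_of_tree sT.
  exists s; last by exists T.
  by rewrite mem_enum inE -av132_parcs es; apply: av132_tarcs.
- move=> s w w' [T [sT sw eT ew]] [T' [sT' sw' eT' ew']].
  apply: unfold_path_inj; first by rewrite sw sw'.
  rewrite ew ew'; congr dyck; apply: (@tarcs_inj _ _ 0 0); first by rewrite sT sT'.
  by rewrite -eT -eT'.
- move=> s s' w [T [_ _ eT ew]] [T' [_ _ eT' ew']].
  have e : T = T' by apply: dyck_inj; rewrite -ew.
  by apply: parcs_inj; rewrite eT eT' e.
move=> s w _ _ [T [sT sw eT ew]].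
rewrite (fpm_nodes sT sw ew) (excm_nodes sT sw ew) (crsm_nodes sT sw ew) -eT.
congr (_ ^+ _ * _ ^+ _ * _ ^+ _)%R.
- rewrite /fpA big_parcs /st_fp card_set_sum.
  by apply: eq_bigr => i _; rewrite eq_sym.
- by rewrite /excA big_parcs /st_exc card_set_sum.
rewrite /crsA big_parcs st_crsE; apply: eq_bigr => i _.
by rewrite big_parcs.
Qed.

(** * The three equivalence classes *)

Lemma wilf_132_321 : wilf_equiv [tuple st_fp; st_exc; st_crs] p132 p321.
Proof.
move=> n; rewrite /gen_poly.
pose X (i : nat) : {mpoly int[3]} := ('X_(inord i))%R.
have E (s : 'S_n) :
    (\prod_(i < 3) 'X_i ^+ tnth [tuple st_fp; st_exc; st_crs] i n s =
     X 0 ^+ st_fp s * X 1 ^+ st_exc s * X 2 ^+ st_crs s)%R.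
  rewrite !big_ord_recl big_ord0 mulr1 mulrA /X.
  by congr ('X_ _ ^+ _ * 'X_ _ ^+ _ * 'X_ _ ^+ _)%R; apply: val_inj; rewrite /= inordK.
rewrite (eq_bigr _ (fun s _ => E s)) [RHS](eq_bigr _ (fun s _ => E s)).
by rewrite sum_av132 sum_av321.
Qed.

Theorem theorem4p2 :
  [/\ forall tau : 'S_3,
        wilf_class [tuple st_fp; st_exc; st_inv; st_crs; st_nes] p132 tau
          <-> tau \in [set p132; p213],
      forall tau : 'S_3,
        wilf_class [tuple st_fp; st_inv; st_nes] p231 tau
          <-> tau \in [set p231; p312]
    & forall tau : 'S_3,
        wilf_class [tuple st_fp; st_exc; st_crs] p132 tau
          <-> tau \in [set p132; p213; p321]].
Proof.
have fp132 : st_fp p132 = 1 by rewrite fp_S3 !one_line3.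
split=> tau; rewrite /wilf_class.
- split=> [/wilf_equiv_stat e|].
    (* One fixed point leaves only the transpositions; [st_inv], being 1 on 132 and 3 on 321, then
       excludes 321. *)
    have : tau \in [set p132; p213; p321].
      apply: S3_fp1; have := e (Ordinal (isT : 0 < 5)); rewrite /tnth /= => <-.
      exact: fp132.
    rewrite !inE => /orP[//|/eqP e321].
    have := e (Ordinal (isT : 2 < 5)); rewrite e321 /tnth /=.
    by rewrite !inv_S3 !one_line3.
  rewrite !inE => /orP[/eqP-> //|/eqP->]; apply: wilf_132_213 => n s.
  case=> [[|[|[|[|[|//]]]]] lt]; rewrite /tnth /=.
  + exact: fp_rci.
  + exact: exc_rci.
  + exact: inv_rci.
  + exact: crs_rci.
  exact: nes_rci.
- split=> [/wilf_equiv_stat e|].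
    apply: S3_fp0; have := e (Ordinal (isT : 0 < 3)); rewrite /tnth /= => <-.
    by rewrite fp_S3 !one_line3.
  rewrite !inE => /orP[/eqP-> //|/eqP->]; apply: wilf_231_312 => n s.
  case=> [[|[|[|//]]] lt]; rewrite /tnth /=.
  + exact: fp_permV.
  + exact: inv_permV.
  exact: nes_permV.
split=> [/wilf_equiv_stat e|].
  apply: S3_fp1; have := e (Ordinal (isT : 0 < 3)); rewrite /tnth /= => <-.
  exact: fp132.
rewrite !inE => /orP[/orP[]|] /eqP-> //; last exact: wilf_132_321.
apply: wilf_132_213 => n s; case=> [[|[|[|//]]] lt]; rewrite /tnth /=.
- exact: fp_rci.
- exact: exc_rci.
exact: crs_rci.
Qed.
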